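(* Let $r$ be a positive integer, let $I=(a,b)$ be an open interval of $\mathbb{R}$ with $a<b$, and for every $t\in I$ let $\mu_t$ be a probability measure on $\{1,\ldots,r\}$. Suppose that for every $k\in\{1,\ldots,r\}$ the function $t\mapsto\mu_t(\{k\})$ is differentiable on $I$; that for every $k\in\{2,\ldots,r\}$ the function $t\mapsto\mu_t(\{k,k+1,\ldots,r\})$ is strictly increasing on $I$; and that $\lim_{t\to a}\mu_t(\{1\})=1$ and $\lim_{t\to b}\mu_t(\{r\})=1$. Let $\nu_{t,\mathbb{N}}=\mu_t^{\otimes\mathbb{N}}$ be the product probability measure on $\{1,\ldots,r\}^{\mathbb{N}}$. Let $A$ be an increasing measurable subset of $\{1,\ldots,r\}^{\mathbb{N}}$, and let $t_1\le t_2$ be two real numbers in $I$. Define $$\gamma_t=\sup_{j\in\mathbb{N}}\nu_{t,\mathbb{N}}(A_j),\qquad \gamma_*=\sup_{t\in[t_1,t_2]}\max\left\{\gamma_t,\ \gamma_t\log\frac{1}{\gamma_t}\right\},$$ $$S^*=\inf_{t\in[t_1,t_2]}\ \inf_{k=2,\ldots,r}\frac{d}{dt}\mu_t(\{k,k+1,\ldots,r\}),$$ where $A_j$ is the set of configurations in $A$ for which coordinate $j$ is pivotal (defined in the context). Then $$\nu_{t_1,\mathbb{N}}(A)\,\bigl(1-\nu_{t_2,\mathbb{N}}(A)\bigr)\le \gamma_*^{\,S^*(t_2-t_1)}.$$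
   Context: $\mathbb{N}=\{0,1,2,\ldots\}$, and $\log$ is the natural logarithm. The space $\{1,\ldots,r\}^{\mathbb{N}}$ carries the product $\sigma$-algebra. A subset $A\subset\{1,\ldots,r\}^{\mathbb{N}}$ is increasing if its indicator function is coordinate-wise nondecreasing, i.e. if $x\in A$ and $x_j\le y_j$ for all $j$, then $y\in A$. For $j\in\mathbb{N}$, the set $A_j$ of configurations in $A$ such that $j$ is pivotal for $A$ is $$A_j=\{x\in\{1,\ldots,r\}^{\mathbb{N}}:\ x\in A \text{ and } x^{(j\to 1)}\notin A\},$$ where $x^{(j\to 1)}$ is the configuration obtained from $x$ by replacing its $j$-th coordinate by $1$ and leaving all other coordinates unchanged. Conventions: $0\log\frac{1}{0}=0$ and $0^0=1$. *)

(* Defs.v *)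
From HB Require Import structures.
From mathcomp Require Import all_boot all_order all_algebra.
From mathcomp Require Import all_classical all_reals all_analysis.

Set Implicit Arguments.
Unset Strict Implicit.
Unset Printing Implicit Defensive.
Import Order.TTheory GRing.Theory Num.Theory.
Import numFieldNormedType.Exports.
Local Open Scope classical_set_scope.
Local Open Scope ring_scope.

(* The alphabet {1, ..., r} with r = n.+1: the ordinal i stands for the letter
   i + 1, so ord0 is the letter 1 and ord_max is the letter r. *)
Notation letter n := 'I_n.+1.

HB.instance Definition _ n := isPointed.Build (letter n) ord0.
HB.instance Definition _ n := @isMeasurable.Build default_measure_display
  (letter n) discrete_measurable discrete_measurable0
  discrete_measurableC discrete_measurableU.

Definition upset n (k : letter n) : set (letter n) :=
  [set l : letter n | (k <= l)%N].

Definition coord_sets n : set (set (nat -> letter n)) :=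
  [set C | exists (j : nat) (B : set (letter n)), C = [set x | B (x j)]].

(* {1, ..., r}^N with the product sigma-algebra, i.e. the one generated by the
   coordinate maps. *)
Definition config n := g_sigma_algebraType (@coord_sets n).

(* nu is the product measure mu^{\otimes N}, characterized by its values on
   the finite-dimensional rectangles (a generating pi-system). *)
Definition is_product_measure (R : realType) n
    (mu : probability (letter n) R) (nu : probability (config n) R) : Prop :=
  forall (m : nat) (B : nat -> set (letter n)),
    nu [set x : config n | forall j, (j < m)%N -> B j (x j)]
    = (\prod_(j < m) fine (mu (B j)))%:E.

Definition increasing n (A : set (config n)) : Prop :=
  forall x y : config n, A x -> (forall j, (x j <= y j)%N) -> A y.

Definition reset n (j : nat) (x : config n) : config n :=
  fun i => if i == j then ord0 else x i.

Definition pivotal n (A : set (config n)) (j : nat) : set (config n) :=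
  [set x | A x /\ ~ A (reset j x)].

Section thresholds.
Context {R : realType} {n : nat}.

Definition gamma (nu : R -> probability (config n) R) (A : set (config n))
    (t : R) : R :=
  sup [set fine (nu t (pivotal A j)) | j in [set: nat]].

(* If g = 0 then g * ln g^-1 = 0, as g^-1 = 0 and ln 0 = 0 in the library. *)
Definition gamma_star (nu : R -> probability (config n) R)
    (A : set (config n)) (t1 t2 : R) : R :=
  sup [set Num.max (gamma nu A t) (gamma nu A t * ln (gamma nu A t)^-1)
      | t in `[t1, t2]].

(* The infimum is taken in \bar R: when r = 1 no k is admissible and S^* is
   +oo. *)
Definition S_star (mu : R -> probability (letter n) R) (t1 t2 : R) : \bar R :=
  ereal_inf [set ereal_inf [set (derive1 (fun s => fine (mu s (upset k))) t)%:E
                           | k in [set k : letter n | (0 < k)%N]]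
            | t in `[t1, t2]].

(* g to the power s for g >= 0 and an extended real exponent s; for s = +oo it
   is the limit of g `^ u as u tends to +oo, and at -oo it is the inverse of the
   value at +oo. In particular 0 to the power 0 is 1. *)
Definition powRe (g : R) (s : \bar R) : \bar R :=
  match s with
  | u%:E => (powR g u)%:E
  | +oo%E => if g < 1 then 0%E else if g == 1 then 1%E else +oo%E
  | -oo%E => if g < 1 then +oo%E else if g == 1 then 1%E else 0%E
  end.

End thresholds.

(* Main.v *)
Require Import Defs.
From HB Require Import structures.
From mathcomp Require Import all_boot all_order all_algebra.
From mathcomp Require Import all_classical all_reals all_analysis.
From mathcomp Require Import ring lra.
Set Implicit Arguments.
Unset Strict Implicit.
Unset Printing Implicit Defensive.
Import Order.TTheory GRing.Theory Num.Theory.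
Import numFieldNormedType.Exports.
Local Open Scope classical_set_scope.
Local Open Scope ring_scope.

(** Write [g t] for the probability of [A] at parameter [t]. The core is the
    bound [J >= g (1 - g) log (1/c)] on the total influence [J] (the expected
    number of coordinates on which membership in [A] depends), valid as soon as
    [gamma <= c] and [gamma log (1/c) <= c]. It comes from the
    Falik-Samorodnitsky argument, based on a logarithmic Sobolev inequality for
    one letter whose energy is at most [1 + e] on every threshold function
    [1_{>= m}], whatever the distribution of the letter. That inequality is
    obtained by iterated splitting of the letter at its median: each fair
    two-point split contributes [1/2], and the depths sum to
    [1/2 + 1/4 + ... = 1].

    Since [g] need not be continuous, the Russo formula is replaced by a lower
    bound on right increments of [g]: the first [m] letters are moved from
    parameter [s] to [t] with the tail frozen at [s], the tail being handled by
    stochastic domination. The lower Dini derivative of [g] is thus at least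
    [S log (1/c) g (1 - g)], and the monotone function [g] is compared with the
    logistic equation. Events depending on infinitely many letters are reduced
    to cylinders by outer regularity of the product measure. *)

(** * Tangent-line bounds for the logarithm and the two-point logarithmic Sobolev inequality *)

Section real_inequalities.
Context {R : realType}.
Implicit Types (x y z t u : R).

Lemma ln_le_subr1 x : 0 < x -> ln x <= x - 1.
Proof. by move=> x0; have := @le_ln1Dx R (x - 1); rewrite subrKC; apply; lra. Qed.

(** Convexity: [u * ln u] lies above its tangent at [t]. This is what linearizes entropies later
    on. *)
Lemma xlnx_tangent t u : 0 < t -> 0 <= u -> u * ln t + u - t <= u * ln u.
Proof.
move=> t0; rewrite le_eqVlt => /predU1P[<-|u0]; first by rewrite !mul0r; lra.
have := @ln_le_subr1 (t / u) (divr_gt0 t0 u0).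
rewrite ln_div ?posrE// => h.
have : u * (ln t - ln u) <= u * (t / u - 1) by rewrite ler_pM2l.
by rewrite !mulrBr mulrCA divff ?gt_eqF//; lra.
Qed.

Lemma ler0_derive_nincr1y (f df : R -> R) :
  (forall x, 1 <= x -> is_derive x 1 f (df x)) ->
  (forall x, 1 <= x -> df x <= 0) ->
  forall x, 1 <= x -> f x <= f 1.
Proof.
move=> fdf df0 x x1.
apply: (@ler0_derive1_nincr R f 1 x) => //.
- move=> y; rewrite in_itv/= => /andP[y1 _].
  by have [] := fdf y (ltW y1).
- move=> y; rewrite in_itv/= => /andP[y1 _].
  by rewrite derive1E; have /@derive_val -> := fdf y (ltW y1); exact/df0/ltW.
- apply: derivable_within_continuous => y; rewrite in_itv/= => /andP[y1 _].
  by have [] := fdf y y1.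
Qed.

(** The function [2 y ln y - y^2] is nonincreasing on [[1, +oo)]. The second-order accuracy at 1
    matters for the two-point inequality, where [ln x <= x - 1] would be too weak. *)
Lemma ln_le_half_subV x : 1 <= x -> ln x <= (x - x^-1) / 2.
Proof.
move=> x1; have x0 : 0 < x by lra.
pose f (y : R) := y * ln y *+ 2 - y ^+ 2.
have : f x <= f 1.
  apply: (@ler0_derive_nincr1y f (fun y => (ln y + 1 - y) *+ 2)) => // y y1.
    have y0 : 0 < y by lra.
    have := is_derive1_ln y0 => ?.
    rewrite /f; apply: is_derive_eq.
    by rewrite /GRing.scale/=; field; rewrite gt_eqF.
  by have := @ln_le_subr1 y; rewrite -mulr_natr; nra.
rewrite /f ln1 mulr0 mul0rn sub0r expr1n -mulr_natr => h.
have -> : (x - x^-1) / 2 = (x ^+ 2 - 1) / 2 / x by field; rewrite gt_eqF.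
by rewrite ler_pdivlMr//; lra.
Qed.

(** Both sides are homogeneous of degree two, so for [0 < y <= x] only the ratio [x / y] counts. The
    left side minus the right side is nonincreasing in that ratio and vanishes when it is 1. *)
Lemma two_point_logSobolev x y : 0 <= x -> 0 <= y ->
  (x ^+ 2 * ln (x ^+ 2) + y ^+ 2 * ln (y ^+ 2)) / 2
    - (x ^+ 2 + y ^+ 2) / 2 * ln ((x ^+ 2 + y ^+ 2) / 2)
    <= (x - y) ^+ 2 / 2.
Proof.
wlog yx : x y / y <= x => [H x0 y0|x0].
  have [/H/(_ x0 y0)//|/ltW/H/(_ y0 x0)] := leP y x.
  by rewrite (addrC (y ^+ 2)) (addrC (y ^+ 2 * _)) -(opprB x y) sqrrN.
(* For [y = 0] the left side is [x^2 * ln 2 / 2], and [ln 2 <= 1]. *)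
rewrite le_eqVlt => /predU1P[<-|y0].
  rewrite expr0n/= mul0r !addr0 subr0.
  move: x0; rewrite le_eqVlt => /predU1P[<-|x0]; first by rewrite expr0n !mul0r subrr.
  have x20 : 0 < x ^+ 2 by rewrite exprn_gt0.
  have := @ln_le_subr1 2 ltac:(lra).
  rewrite ln_div ?posrE//; nra.
pose f (z : R) := (z ^+ 2 * ln z) - (z ^+ 2 + 1) / 2 * ln ((z ^+ 2 + 1) / 2)
   - (z - 1) ^+ 2 / 2.
suff h : f (x / y) <= f 1.
  have y2 : 0 < y ^+ 2 by rewrite exprn_gt0.
  have x0' : 0 < x by lra.
  have x2 : 0 < x ^+ 2 by rewrite exprn_gt0.
  have : y ^+ 2 * f (x / y) <= 0.
    rewrite pmulr_rle0// (le_trans h)// /f ln1 expr1n.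
    by rewrite (_ : (1 + 1) / 2 = 1) ?ln1; lra.
  rewrite /f ln_div ?posrE//.
  have -> : ((x / y) ^+ 2 + 1) / 2 = ((x ^+ 2 + y ^+ 2) / 2) / y ^+ 2.
    by field; rewrite gt_eqF.
  rewrite (@ln_div _ (_ / 2)) ?posrE//; last lra.
  rewrite !lnXn// expr_div_n; set lx := ln x; set ly := ln y; set ls := ln _.
  set L := (X in X <= 0 -> _) => L0.
  rewrite -subr_le0; apply: le_trans L0; rewrite le_eqVlt; apply/orP; left.
  by apply/eqP; rewrite /L; field; rewrite gt_eqF.
apply: (@ler0_derive_nincr1y f (fun z => z * (ln (z ^+ 2) - ln ((z ^+ 2 + 1) / 2)) - (z - 1))).
- move=> z z1; have z0 : 0 < z by lra.
  have z20 : 0 < (z ^+ 2 + 1) / 2 by nra.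
  have := is_derive1_ln z0 => ?.
  have := is_derive1_ln z20 => ?.
  rewrite /f; apply: is_derive_eq.
  by rewrite /GRing.scale/= lnXn//; field; rewrite !gt_eqF//; nra.
- move=> z z1; have z0 : 0 < z by lra.
  have z2 : 1 <= z ^+ 2 by nra.
  rewrite -ln_div ?posrE; [|nra|nra].
  rewrite invf_div mulrCA mulrA; set w := (X in ln X).
  have w1 : 1 <= w by rewrite /w ler_pdivlMr; nra.
  have := ln_le_half_subV w1.
  suff : z * ((w - w^-1) / 2) <= z - 1 by nra.
  rewrite -subr_ge0.
  (* With [w = 2 z^2 / (z^2 + 1)], the slack left by [ln_le_half_subV] is an explicit fourth
     power. *)
  have -> : z - 1 - z * ((w - w^-1) / 2) =
    (z - 1) ^+ 4 / (4 * z * (z ^+ 2 + 1)).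
    by rewrite /w; field; rewrite !gt_eqF//; nra.
  by rewrite divr_ge0 ?exprn_even_ge0//; nra.
- by rewrite ler_pdivlMr// mul1r.
Qed.

End real_inequalities.

(** * Means, quadratic forms and entropies for a single letter *)

Section one_letter.
Context {R : realType} {n : nat}.
Notation X := (letter n).
Implicit Types (p q : X -> R) (g h : X -> R) (w : X -> X -> R).

Definition is_weight p := (forall i, 0 <= p i) /\ \sum_i p i = 1.

Definition mean p g : R := \sum_i p i * g i.

Definition diff_form w g : R := \sum_i \sum_j w i j * (g i - g j) ^+ 2.

Definition up (m : nat) (i : X) : R := (m <= i)%N%:R.

(* At [0] the junk value [ln 0 = 0] gives the usual convention. *)
Definition xlnx (u : R) : R := u * ln u.

(** Here [diff_form w] is a Dirichlet form normalized to logarithmic Sobolev constant 1, and [C]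
    bounds its energy on thresholds. Confining [w] to pairs charged by [p] makes a threshold that is
    constant on the support of [p] cost nothing. *)
Definition logSobolev_form p w (C : R) := [/\ forall i j, 0 <= w i j,
  forall i j, p i * p j = 0 -> w i j = 0,
  forall g, mean p (fun i => xlnx (g i ^+ 2))
            - xlnx (mean p (fun i => g i ^+ 2)) <= diff_form w g &
  forall m, diff_form w (up m) <= C].

Lemma mean_le p g h : is_weight p -> (forall i, g i <= h i) ->
  mean p g <= mean p h.
Proof. by move=> [p0 _] gh; apply: ler_sum => i _; rewrite ler_wpM2l. Qed.

Lemma mean_ge0 p g : is_weight p -> (forall i, 0 <= g i) -> 0 <= mean p g.
Proof. by move=> [p0 _] g0; apply: sumr_ge0 => i _; rewrite mulr_ge0. Qed.

Lemma mean_cst p c : is_weight p -> mean p (fun=> c) = c.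
Proof. by move=> [_ p1]; rewrite /mean -mulr_suml p1 mul1r. Qed.

Lemma meanZ p c g : mean p (fun i => c * g i) = c * mean p g.
Proof. by rewrite /mean mulr_sumr; apply: eq_bigr => i _; rewrite mulrCA. Qed.

Lemma meanD p g h : mean p (fun i => g i + h i) = mean p g + mean p h.
Proof. by rewrite /mean -big_split; apply: eq_bigr => i _; rewrite mulrDr. Qed.

Lemma meanB p g h : mean p (fun i => g i - h i) = mean p g - mean p h.
Proof. by rewrite /mean -sumrB; apply: eq_bigr => i _; rewrite mulrBr. Qed.

(** The double sum is an expectation under the independent coupling of [p] and [q], where the cross
    term factorizes. *)
Lemma mean_coupling p q g h : is_weight p -> is_weight q ->
  \sum_i \sum_j p i * q j * (g i - h j) ^+ 2 =
  mean p (fun i => g i ^+ 2) - 2 * mean p g * mean q h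
  + mean q (fun j => h j ^+ 2).
Proof.
move=> wp wq.
transitivity (mean p (fun i => mean q (fun j => (g i - h j) ^+ 2))).
  by apply: eq_bigr => i _; rewrite mulr_sumr; apply: eq_bigr => j _; rewrite mulrA.
rewrite (_ : (fun i => _) = fun i => g i ^+ 2 - 2 * mean q h * g i
    + mean q (fun j => h j ^+ 2)); last first.
  apply/funext => i.
  rewrite (_ : (fun j => _) = fun j => g i ^+ 2 - 2 * g i * h j + h j ^+ 2); last first.
    by apply/funext => j; ring.
  by rewrite meanD meanB mean_cst// meanZ; ring.
by rewrite meanD meanB mean_cst// meanZ; ring.
Qed.

Lemma mean_sqr_le p g : is_weight p -> mean p g ^+ 2 <= mean p (fun i => g i ^+ 2).
Proof.
move=> wp; have := @mean_coupling p p g g wp wp.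
have : 0 <= \sum_i \sum_j p i * p j * (g i - g j) ^+ 2.
  apply: sumr_ge0 => i _; apply: sumr_ge0 => j _.
  by case: wp => p0 _; rewrite mulr_ge0 ?sqr_ge0// mulr_ge0.
by move=> + e; rewrite e; nra.
Qed.

Lemma CauchySchwarz_mean p g h : is_weight p ->
  mean p (fun i => g i * h i) <=
  Num.sqrt (mean p (fun i => g i ^+ 2)) * Num.sqrt (mean p (fun i => h i ^+ 2)).
Proof.
move=> wp; set a := mean p _; set b := mean p _; set c := mean p _.
have b0 : 0 <= b by apply: mean_ge0 => // i; exact: sqr_ge0.
have c0 : 0 <= c by apply: mean_ge0 => // i; exact: sqr_ge0.
have quad t : 0 <= b - 2 * t * a + t ^+ 2 * c.
  rewrite /a /b /c -!meanZ -meanB -meanD; apply: mean_ge0 => // i.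
  by rewrite (_ : _ + _ = (g i - t * h i) ^+ 2) ?sqr_ge0//; ring.
rewrite -sqrtrM//; apply: le_trans (ler_norm _) _.
rewrite -sqrtr_sqr ler_sqrt ?mulr_ge0//.
move: c0; rewrite le_eqVlt => /predU1P[c0|c0].
  rewrite -c0 mulr0; have [->|a0] := eqVneq a 0; first by rewrite expr0n.
  (* With [c = 0] the quadratic is affine in [t]; this [t] makes it equal to -1 unless [a = 0]. *)
  have := quad ((b + 1) / (2 * a)); rewrite -c0 mulr0 addr0.
  rewrite (_ : 2 * _ * a = b + 1); last by field.
  by rewrite opprD addrA subrr sub0r lerNr oppr0 lt_geF.
have := quad (a / c).
rewrite (_ : b - _ + _ = (b * c - a ^+ 2) / c); last by field; rewrite gt_eqF.
by rewrite pmulr_lge0 ?invr_gt0// subr_ge0.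
Qed.

(** Reverse triangle inequality in [L^2(p)], squared. *)
Lemma sqrt_mean_dist p g h : is_weight p ->
  (Num.sqrt (mean p (fun i => g i ^+ 2)) - Num.sqrt (mean p (fun i => h i ^+ 2))) ^+ 2
  <= mean p (fun i => (g i - h i) ^+ 2).
Proof.
move=> wp; have := CauchySchwarz_mean g h wp.
have -> : (fun i => (g i - h i) ^+ 2) =
    fun i => g i ^+ 2 - 2 * (g i * h i) + h i ^+ 2.
  by apply/funext => i; ring.
rewrite meanD meanB meanZ sqrrB !sqr_sqrtr; first by lra.
all: by apply: mean_ge0 => // i; exact: sqr_ge0.
Qed.

Lemma diff_form_ge0 w g : (forall i j, 0 <= w i j) -> 0 <= diff_form w g.
Proof.
move=> w0; apply: sumr_ge0 => i _; apply: sumr_ge0 => j _.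
by rewrite mulr_ge0 ?sqr_ge0.
Qed.

(** Crude starting point of the splitting recursion, with weights bounded uniformly in [p]. Entropy
    is at most variance over mean, and the variance of [g ^+ 2] is a double sum of squares that
    factor as [(g i - g j) ^+ 2 * (g i + g j) ^+ 2]. *)
Lemma entropy_sqr_le_pairs p g : is_weight p ->
  mean p (fun i => xlnx (g i ^+ 2)) - xlnx (mean p (fun i => g i ^+ 2))
  <= diff_form (fun i j => if p i * p j == 0 then 0 else 2) g.
Proof.
move=> wp; have [p0 p1] := wp; set s := mean p (fun i => g i ^+ 2).
have pg0 i : 0 <= p i * g i ^+ 2 by rewrite mulr_ge0// sqr_ge0.
have pgs i : p i * g i ^+ 2 <= s.
  by rewrite /s /mean (bigD1 i)//= lerDl; apply: sumr_ge0.
have s0 : 0 <= s by exact: sumr_ge0.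
have p_le1 i : p i <= 1.
  by rewrite -p1 (bigD1 i)//= lerDl; apply: sumr_ge0.
have w0 : 0 <= diff_form (fun i j => if p i * p j == 0 then 0 else 2) g.
  by apply: diff_form_ge0 => i j; case: ifP.
move: (s0); rewrite le_eqVlt => /predU1P[s00|s_gt0].
  rewrite /xlnx -s00 mul0r subr0 /mean big1// => i _.
  rewrite mulrA; suff -> : p i * g i ^+ 2 = 0 by rewrite mul0r.
  by apply/eqP; rewrite eq_le pg0 s00 pgs.
have : mean p (fun i => xlnx (g i ^+ 2)) - xlnx s <=
    (mean p (fun i => (g i ^+ 2) ^+ 2) - s ^+ 2) / s.
  rewrite (_ : (_ - s ^+ 2) / s = s^-1 * mean p (fun i => (g i ^+ 2) ^+ 2) - s); last first.
    by field; rewrite gt_eqF.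
  rewrite [xlnx s]mulrC {1}/s -!meanZ -!meanB; apply: mean_le => // i.
  rewrite /xlnx; have [->|gi0] := eqVneq (g i) 0.
    by rewrite expr0n/= !(mul0r, mulr0, expr0n, subr0).
  have g2 : 0 < g i ^+ 2 by rewrite exprn_even_gt0.
  have := @ln_le_subr1 R (g i ^+ 2 / s) (divr_gt0 g2 s_gt0).
  rewrite ln_div ?posrE// -(ler_pM2l g2) => h; lra.
move=> /le_trans; apply; rewrite ler_pdivrMr//.
have := mean_coupling (fun i => g i ^+ 2) (fun i => g i ^+ 2) wp wp.
rewrite -/s => e.
have -> : mean p (fun i => (g i ^+ 2) ^+ 2) - s ^+ 2 =
  2^-1 * \sum_i \sum_j p i * p j * (g i ^+ 2 - g j ^+ 2) ^+ 2.
  by rewrite e; field.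
rewrite /diff_form mulr_sumr mulr_suml; apply: ler_sum => i _.
rewrite mulr_sumr mulr_suml; apply: ler_sum => j _.
case: ifPn => [/eqP ->|_]; first by rewrite !(mul0r, mulr0).
rewrite subr_sqr exprMn.
have : (g i + g j) ^+ 2 <= 2 * (g i ^+ 2 + g j ^+ 2).
  by rewrite -subr_ge0 (_ : _ - _ = (g i - g j) ^+ 2) ?sqr_ge0//; ring.
move=> h1.
have h2 : p i * p j * (g i + g j) ^+ 2 <= 4 * s.
  have : p i * p j * (g i + g j) ^+ 2 <= p i * p j * (2 * (g i ^+ 2 + g j ^+ 2)).
    by rewrite ler_wpM2l// mulr_ge0.
  have := pgs i; have := pgs j; have := pg0 i; have := pg0 j.
  have := p_le1 i; have := p_le1 j; have := p0 i; have := p0 j.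
  set A := p i * g i ^+ 2; set B := p j * g j ^+ 2 => *.
  have : p i * p j * (2 * (g i ^+ 2 + g j ^+ 2)) = 2 * (p j * A + p i * B).
    by rewrite /A /B; ring.
  by nra.
have := sqr_ge0 (g i - g j); set d := _ ^+ 2 => d0.
have -> : 2^-1 * (p i * p j * (d * (g i + g j) ^+ 2)) =
  2^-1 * d * (p i * p j * (g i + g j) ^+ 2) by ring.
have : 2^-1 * d * (p i * p j * (g i + g j) ^+ 2) <= 2^-1 * d * (4 * s).
  by rewrite ler_wpM2l// mulr_ge0.
lra.
Qed.

End one_letter.

(** * Splitting a letter at its median; decomposition of functions into thresholds *)

Section binary_splitting.
Context {R : realType} {n : nat}.
Notation X := (letter n).
Implicit Types (p : X -> R) (g : X -> R) (w : X -> X -> R).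

Lemma diff_formD w1 w2 g :
  diff_form (fun i j => w1 i j + w2 i j) g = diff_form w1 g + diff_form w2 g.
Proof.
rewrite /diff_form -big_split; apply: eq_bigr => i _.
by rewrite -big_split; apply: eq_bigr => j _; rewrite mulrDl.
Qed.

Lemma diff_formZ c w g :
  diff_form (fun i j => c * w i j) g = c * diff_form w g.
Proof.
rewrite /diff_form mulr_sumr; apply: eq_bigr => i _.
by rewrite mulr_sumr; apply: eq_bigr => j _; rewrite mulrA.
Qed.

Lemma sqr_up_diff m (i j : X) : (up m i - up m j : R) ^+ 2 = `|up m i - up m j|.
Proof.
by rewrite /up; case: (m <= i)%N; case: (m <= j)%N;
  rewrite ?subrr ?subr0 ?sub0r ?expr0n ?sqrrN ?expr1n ?normrN ?normr1 ?normr0.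
Qed.

Lemma sqr_up_diff_le1 m (i j : X) : (up m i - up m j : R) ^+ 2 <= 1.
Proof.
by rewrite /up; case: (m <= i)%N; case: (m <= j)%N;
  rewrite ?subrr ?subr0 ?sub0r ?expr0n ?sqrrN ?expr1n.
Qed.

(* The lower and upper halves of a distribution: the letter containing the
   median is shared between them. *)
Lemma halves p : is_weight p -> exists l u : X -> R,
  [/\ is_weight l, is_weight u, forall i, p i = (l i + u i) / 2 &
      forall m : nat, (forall i : X, (m <= i)%N -> l i = 0) \/
                (forall i : X, (i < m)%N -> u i = 0)].
Proof.
move=> [p0 p1]; pose c (k : nat) : R := \sum_(i < n.+1 | (i < k)%N) p i.
have cS (i : X) : c i.+1 = c i + p i.
  rewrite /c (bigD1 i)//= addrC; congr (_ + _); apply: eq_bigl => j.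
  by rewrite ltnS ltn_neqAle andbC.
have c_le (k l : nat) : (k <= l)%N -> c k <= c l.
  move=> kl; rewrite /c [leRHS](bigID (fun i : X => (i < k)%N))/=.
  have -> : \sum_(i < n.+1 | (i < l)%N && (i < k)%N) p i = c k.
    apply: eq_bigl => i; case: (ltnP i k) => ik; rewrite ?andbF// andbT.
    exact: leq_trans ik kl.
  by rewrite lerDl sumr_ge0.
have c0 : c 0%N = 0 by rewrite /c big_pred0.
have cn : c n.+1 = 1.
  by rewrite -p1 /c; apply: eq_bigl => i; rewrite ltn_ord.
(* Since [c k] is the mass strictly below the letter [k], the two truncations at [1 / 2] are, after
   doubling, cumulative masses of the two halves, the upper one shifted by 1. *)
pose lo k : R := 2 * Num.min (c k) (1 / 2).
pose hi k : R := 2 * Num.max (c k) (1 / 2).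
exists (fun i => lo i.+1 - lo i), (fun i => hi i.+1 - hi i); split.
- split=> [i|].
    rewrite subr_ge0 /lo ler_pM2l// le_min ge_min c_le//= ge_min lexx orbT//.
  rewrite -(big_mkord predT (fun i => lo i.+1 - lo i)) telescope_sumr// /lo c0 cn.
  by rewrite (@min_r _ _ 1) ?(@min_l _ _ 0); lra.
- split=> [i|].
    rewrite subr_ge0 /hi ler_pM2l// ge_max le_max c_le//= le_max lexx orbT//.
  rewrite -(big_mkord predT (fun i => hi i.+1 - hi i)) telescope_sumr// /hi c0 cn.
  by rewrite (@max_l _ _ 1) ?(@max_r _ _ 0); lra.
- move=> i; rewrite /lo /hi cS.
  by case: (leP (c i) (1 / 2)); case: (leP (c i + p i) (1 / 2)); lra.
- move=> m; have [cm|cm] := leP (c m) (1 / 2); [right|left] => i im.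
    have h1 := c_le _ _ im; have h2 := c_le _ _ (leqnSn i).
    by rewrite /hi !max_r ?subrr//; lra.
  have h1 := c_le _ _ im; have h2 := c_le _ _ (leqnSn i).
  by rewrite /lo !min_r ?subrr//; lra.
Qed.

Lemma diff_form_up_eq0 p w m : (forall i j, p i * p j = 0 -> w i j = 0) ->
  (forall i : X, (m <= i)%N -> p i = 0) \/ (forall i : X, (i < m)%N -> p i = 0) ->
  diff_form w (up m) = 0.
Proof.
move=> pw pm; rewrite /diff_form big1// => i _; rewrite big1// => j _.
have [ij|/eqP ij] := eqVneq ((m <= i)%N) ((m <= j)%N).
  by rewrite /up ij subrr expr0n mulr0.
rewrite pw ?mul0r//; apply/eqP; rewrite mulf_eq0.
case: pm => pm; move: ij; case: (leqP m i) => mi; case: (leqP m j) => mj // _.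
all: by rewrite ?(pm _ mi) ?(pm _ mj) eqxx ?orbT.
Qed.

(** The entropy under [p] is the average of those under [l] and [u] plus that of a fair two-valued
    variable, the latter being handled by [two_point_logSobolev]. A threshold can be nonconstant on
    one half only, so a single [C / 2] enters the energy bound instead of two. *)
Lemma logSobolev_form_halves p l u wl wu C :
  is_weight l -> is_weight u -> (forall i, p i = (l i + u i) / 2) ->
  (forall m : nat, (forall i : X, (m <= i)%N -> l i = 0) \/
             (forall i : X, (i < m)%N -> u i = 0)) ->
  logSobolev_form l wl C -> logSobolev_form u wu C ->
  logSobolev_form p
    (fun i j => 2^-1 * (l i * u j) + (2^-1 * wl i j + 2^-1 * wu i j))
    (2^-1 * (1 + C)).
Proof.
move=> hl hu pE lu [wl0 wls wlE wlC] [wu0 wus wuE wuC].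
have [[l0 l1] [u0 u1]] := (hl, hu).
split.
- by move=> i j; do !(apply: addr_ge0 || apply: mulr_ge0) => //.
- move=> i j /eqP; rewrite mulf_eq0 !pE => ij.
  have [h1 h2] : l i * l j = 0 /\ u i * u j = 0.
    move: ij (l0 i) (l0 j) (u0 i) (u0 j) => /orP[] /eqP h a1 a2 a3 a4.
      have -> : l i = 0 by lra.
      by have -> : u i = 0; [lra|rewrite !mul0r].
    have -> : l j = 0 by lra.
    by have -> : u j = 0; [lra|rewrite !mulr0].
  have h3 : l i * u j = 0.
    move: ij (l0 i) (l0 j) (u0 i) (u0 j) => /orP[] /eqP h a1 a2 a3 a4.
      by have -> : l i = 0; [lra|rewrite !mul0r].
    by have -> : u j = 0; [lra|rewrite !mulr0].
  by rewrite wls// wus// h3 !mulr0 !addr0.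
- move=> g.
  have meanE h : mean p h = (mean l h + mean u h) / 2.
    rewrite /mean -big_split/= mulr_suml; apply: eq_bigr => i _.
    by rewrite pE; ring.
  rewrite !diff_formD !diff_formZ.
  have := wlE g; have := wuE g; rewrite !meanE.
  set L2 := mean l (fun i => g i ^+ 2); set U2 := mean u (fun i => g i ^+ 2).
  have L20 : 0 <= L2 by apply: mean_ge0 => // i; exact: sqr_ge0.
  have U20 : 0 <= U2 by apply: mean_ge0 => // i; exact: sqr_ge0.
  have := @two_point_logSobolev R (Num.sqrt L2) (Num.sqrt U2) (sqrtr_ge0 _) (sqrtr_ge0 _).
  rewrite sqrrB !sqr_sqrtr//.
  (* The two-point energy, a squared difference of [L^2] norms, is at most the energy of the
     independent coupling of [l] and [u]. *)
  suff : L2 - Num.sqrt L2 * Num.sqrt U2 *+ 2 + U2 <= diff_form (fun i j => l i * u j) g.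
    rewrite /xlnx -/(xlnx _); set D := diff_form (fun i j => l i * u j) g.
    set x := mean l _; set y := mean u _; lra.
  rewrite /diff_form mean_coupling// -/L2 -/U2.
  suff : mean l g * mean u g <= Num.sqrt L2 * Num.sqrt U2 by lra.
  apply: le_trans (ler_norm _) _; rewrite normrM ler_pM//.
    by rewrite -sqrtr_sqr ler_sqrt// mean_sqr_le.
  by rewrite -sqrtr_sqr ler_sqrt// mean_sqr_le.
- move=> m; rewrite !diff_formD !diff_formZ.
  have h1 : diff_form (fun i j => l i * u j) (up m) <= 1.
    apply: (@le_trans _ _ (\sum_i \sum_j l i * u j)).
      apply: ler_sum => i _; apply: ler_sum => j _.
      by rewrite ler_piMr ?sqr_up_diff_le1// mulr_ge0.
    under eq_bigr do rewrite -mulr_sumr u1 mulr1.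
    by rewrite l1.
  have := wuC m; have := wlC m.
  case: (lu m) => h.
    by rewrite (@diff_form_up_eq0 l wl m)//; [lra|left].
  by rewrite (@diff_form_up_eq0 u wu m)//; [lra|right].
Qed.

(** The crude pair form has threshold energy at most [K]. Each halving sends a bound [C] to
    [(1 + C) / 2], whose fixed point is 1, so [N] halvings leave [1 + K / 2^N]. *)
Lemma logSobolev_form_exists p e : is_weight p -> 0 < e ->
  exists w, logSobolev_form p w (1 + e).
Proof.
move=> hp e0; pose K : R := \sum_(i < n.+1) \sum_(j < n.+1) 2.
have K0 : 0 <= K by apply: sumr_ge0 => i _; apply: sumr_ge0.
have [N KN] : exists N : nat, K * 2^-1 ^+ N <= e.
  have /archi_boundP : 0 <= K / e by rewrite divr_ge0// ltW.
  set M := Num.bound _ => KM; exists M.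
  rewrite exprVn ler_pdivrMr ?exprn_gt0// mulrC -ler_pdivrMr//.
  apply: (le_trans (ltW KM)).
  by rewrite -natrX ler_nat ltnW// ltn_expl.
suff [w [w0 ws wE wC]] : exists w, logSobolev_form p w (1 + K * 2^-1 ^+ N).
  by exists w; split=> // m; rewrite (le_trans (wC m))// lerD2l.
elim: N p hp {KN} => [p hp|N IH p hp].
  exists (fun i j => if p i * p j == 0 then 0 else 2); split.
  - by move=> i j; case: ifP.
  - by move=> i j ->; rewrite eqxx.
  - by move=> g; exact: entropy_sqr_le_pairs.
  - move=> m; rewrite expr0 mulr1 ler_wpDl//.
    apply: ler_sum => i _; apply: ler_sum => j _.
    case: ifP => _; first by rewrite mul0r.
    by rewrite ler_piMr// sqr_up_diff_le1.
have [l [u [hl hu pE lu]]] := halves hp.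
have [wl wlP] := IH _ hl; have [wu wuP] := IH _ hu.
exists (fun i j => 2^-1 * (l i * u j) + (2^-1 * wl i j + 2^-1 * wu i j)).
have := logSobolev_form_halves hl hu pE lu wlP wuP.
by rewrite (_ : 2^-1 * _ = 1 + K * 2^-1 ^+ N.+1)// exprS; field.
Qed.

(** Summation by parts: thresholds span all functions of a letter, with nonnegative coefficients
    when [g] is nondecreasing. Bounds on thresholds thereby extend to monotone functions. *)
Lemma abel_letters g i :
  g i = g ord0 + \sum_(m < n) (g (inord m.+1) - g (inord m)) * up m.+1 i.
Proof.
rewrite -(big_mkord predT (fun m => (g (inord m.+1) - g (inord m)) * up m.+1 i)).
rewrite (@big_cat_nat _ _ _ i)//=; last by rewrite -ltnS.
rewrite [X in _ + (_ + X)]big_nat_cond [X in _ + (_ + X)]big1 ?addr0; last first.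
  move=> m /andP[/andP[im _] _]; rewrite /up ltnNge im/= mulr0//.
rewrite (eq_big_nat _ _ (F2 := fun m => g (inord m.+1) - g (inord m))); last first.
  by move=> m /andP[_ mi]; rewrite /up mi mulr1.
rewrite telescope_sumr// inord_val.
by rewrite (_ : inord 0 = ord0) ?subrKC//; apply: val_inj; rewrite /= inordK.
Qed.

Definition nondecr (g : X -> R) := forall i j : X, (i <= j)%N -> g i <= g j.

Lemma nondecr_incr g (m : 'I_n) : nondecr g -> 0 <= g (inord m.+1) - g (inord m).
Proof.
move=> gm; rewrite subr_ge0; apply: gm; rewrite !inordK//.
  by rewrite ltnS ltn_ord.
by rewrite ltnS ltnW ?ltn_ord.
Qed.

Lemma abel_ord_max g :
  \sum_(m < n) (g (inord m.+1) - g (inord m)) = g ord_max - g ord0.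
Proof.
rewrite [g ord_max]abel_letters addrC addKr; apply: eq_bigr => m _.
by rewrite /up/= ltn_ord mulr1.
Qed.

Lemma mean_abel p g : is_weight p ->
  mean p g = g ord0 + \sum_(m < n) (g (inord m.+1) - g (inord m)) * mean p (up m.+1).
Proof.
move=> hp; rewrite {1}(_ : g = fun i => g ord0 +
    \sum_(m < n) (g (inord m.+1) - g (inord m)) * up m.+1 i); last first.
  by apply/funext => i; exact: abel_letters.
rewrite meanD mean_cst//; congr (_ + _).
rewrite /mean; under eq_bigr do rewrite mulr_sumr.
rewrite exchange_big; apply: eq_bigr => m _.
by rewrite mulr_sumr; apply: eq_bigr => i _; rewrite mulrCA.
Qed.

(** As [g] takes values in [[0, 1]], squared differences are at most absolute ones. These are
    subadditive over the threshold decomposition, and for a threshold the square and the absolute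
    value coincide. *)
Lemma diff_form_nondecr_le w C g : (forall i j, 0 <= w i j) ->
  (forall m, diff_form w (up m) <= C) -> nondecr g ->
  (forall i, 0 <= g i <= 1) ->
  diff_form w g <= C * (g ord_max - g ord0).
Proof.
move=> w0 wC gm g01.
pose a (m : 'I_n) := g (inord m.+1) - g (inord m).
have sq i j : (g i - g j) ^+ 2 <= \sum_m a m * (up m.+1 i - up m.+1 j) ^+ 2.
  apply: (@le_trans _ _ `|g i - g j|).
    rewrite -real_normK ?num_real// expr2 ler_piMr//.
    have := g01 i; have := g01 j; rewrite ler_norml => /andP[? ?] /andP[? ?].
    by apply/andP; split; lra.
  rewrite (abel_letters g i) (abel_letters g j) opprD addrACA subrr add0r -sumrB.
  apply: le_trans (ler_norm_sum _ _ _) _; apply: ler_sum => m _.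
  by rewrite -mulrBr normrM sqr_up_diff ger0_norm ?nondecr_incr.
apply: (@le_trans _ _ (\sum_m a m * diff_form w (up m.+1))).
  rewrite /diff_form.
  under [leRHS]eq_bigr do rewrite mulr_sumr.
  rewrite [leRHS]exchange_big; apply: ler_sum => i _.
  under [leRHS]eq_bigr do rewrite mulr_sumr.
  rewrite [leRHS]exchange_big; apply: ler_sum => j _.
  under [leRHS]eq_bigr do rewrite mulrCA.
  by rewrite -mulr_sumr ler_wpM2l// sq.
rewrite -abel_ord_max mulr_sumr; apply: ler_sum => m _.
by rewrite mulrC ler_wpM2r// ?wC// nondecr_incr.
Qed.

(** Two controls of the same deviation: the first is summed over coordinates to give half the total
    influence, the second bounds each coordinate by a pivotal probability. *)
Lemma mean_abs_dev_le_half p g : is_weight p ->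
  (forall i, g ord0 <= g i <= g ord_max) ->
  mean p (fun i => `|g i - mean p g|) <= (g ord_max - g ord0) / 2 /\
  mean p (fun i => `|g i - mean p g|) <= 2 * (mean p g - g ord0).
Proof.
move=> hp g01; set c := mean p g; set x := g ord0; set y := g ord_max.
have cx : x <= c.
  by rewrite -(mean_cst x hp); apply: mean_le => // i; have /andP[] := g01 i.
have cy : c <= y.
  by rewrite -(mean_cst y hp); apply: mean_le => // i; have /andP[] := g01 i.
(* Convexity of [|. - c|]: it lies below its chord over [[x, y]]. *)
have chord : (y - x) * mean p (fun i => `|g i - c|) <= 2 * ((y - c) * (c - x)).
  rewrite -meanZ.
  apply: (@le_trans _ _ (mean p (fun i => (c - x) * (y - g i) + (y - c) * (g i - x)))).
    apply: mean_le => // i; have /andP[] := g01 i; rewrite -/x -/y => h1 h2.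
    have h3 : 0 <= (c - x) * (y - g i) by rewrite mulr_ge0// subr_ge0.
    have h4 : 0 <= (y - c) * (g i - x) by rewrite mulr_ge0// subr_ge0.
    by have [h|h] := lerP c (g i); lra.
  by rewrite meanD !meanZ !meanB !mean_cst// -/c; lra.
have m0 : 0 <= mean p (fun i => `|g i - c|) by apply: mean_ge0.
have : x <= y by lra.
rewrite le_eqVlt => /predU1P[xy|xy].
  suff -> : mean p (fun i => `|g i - c|) = 0 by lra.
  rewrite /mean big1// => i _; have /andP[] := g01 i; rewrite -/x -/y => h1 h2.
  by rewrite (_ : g i = c) ?subrr ?normr0 ?mulr0 //; lra.
have yx : 0 < y - x by lra.
split; rewrite -(ler_pM2l yx); apply: le_trans chord _.
  by have := sqr_ge0 ((y - c) - (c - x)); lra.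
have : 0 <= (c - x) * (c - x) by rewrite mulr_ge0// subr_ge0.
by lra.
Qed.

End binary_splitting.

(** * Finite product expectations, tensorization and the lower bound on the total influence *)

Section product_expectation.
Context {R : realType} {n : nat}.
Notation X := (letter n).
Notation T := (nat -> X).
Implicit Types (p : X -> R) (w : X -> X -> R) (F G : T -> R) (s : seq nat) (x : T).

Definition upd (j : nat) (k : X) (x : T) : T := fun i => if i == j then k else x i.

Definition avg p (j : nat) F : T -> R := fun x => mean p (fun k => F (upd j k x)).

(** The head of [s] is integrated first. Coordinates outside [s] keep their values in the base
    configuration, so the result is again a function on configurations. *)
Definition expec p s F : T -> R := foldl (fun G j => avg p j G) F s.

Definition diff_form_at w (j : nat) F : T -> R :=
  fun x => diff_form w (fun k => F (upd j k x)).

Lemma updC i j k l x : i != j -> upd i k (upd j l x) = upd j l (upd i k x).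
Proof.
move=> ij; apply/funext => m; rewrite /upd.
by case: (eqVneq m i) => // ->; rewrite (negbTE ij).
Qed.

Lemma upd_upd j k l x : upd j k (upd j l x) = upd j k x.
Proof. by apply/funext => m; rewrite /upd; case: (m == j). Qed.

Lemma avg_ge0 p j F x : is_weight p -> (forall x, 0 <= F x) -> 0 <= avg p j F x.
Proof. by move=> hp F0; apply: mean_ge0. Qed.

Lemma avg_id p j F : is_weight p -> (forall k x, F (upd j k x) = F x) ->
  avg p j F = F.
Proof.
move=> hp FE; apply/funext => x; rewrite /avg.
by rewrite (_ : (fun k => _) = fun=> F x) ?mean_cst//; apply/funext => k.
Qed.

Lemma avgC p i j F : avg p i (avg p j F) = avg p j (avg p i F).
Proof.
have [->//|ij] := eqVneq i j; apply/funext => x; rewrite /avg /mean.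
under eq_bigr do rewrite mulr_sumr; under [RHS]eq_bigr do rewrite mulr_sumr.
rewrite exchange_big; apply: eq_bigr => k _; apply: eq_bigr => l _.
by rewrite mulrCA updC// eq_sym.
Qed.

Lemma avgB p j F G : avg p j (fun x => F x - G x) = fun x => avg p j F x - avg p j G x.
Proof. by apply/funext => x; rewrite /avg meanB. Qed.

Lemma avg_avg p j F : is_weight p -> avg p j (avg p j F) = avg p j F.
Proof.
move=> hp; apply: avg_id => // k x; rewrite /avg.
by congr mean; apply/funext => l; rewrite upd_upd.
Qed.

Lemma expec_le p s F G x : is_weight p -> (forall x, F x <= G x) ->
  expec p s F x <= expec p s G x.
Proof.
move=> hp; elim: s F G => [//|j s IH] F G FG /=.
by apply: IH => y; apply: mean_le.
Qed.

Lemma expec_cst p s c x : is_weight p -> expec p s (fun=> c) x = c.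
Proof.
by move=> hp; elim: s => [//|j s IH] /=; rewrite avg_id.
Qed.

Lemma expec_ge0 p s F x : is_weight p -> (forall x, 0 <= F x) -> 0 <= expec p s F x.
Proof. by move=> hp F0; rewrite -(expec_cst s 0 x hp); exact: expec_le. Qed.

Lemma expecD p s F G x :
  expec p s (fun x => F x + G x) x = expec p s F x + expec p s G x.
Proof.
elim: s F G => [//|j s IH] F G /=; rewrite -IH; congr (expec _ _ _ x).
by apply/funext => y; rewrite /avg meanD.
Qed.

Lemma expecB p s F G x :
  expec p s (fun x => F x - G x) x = expec p s F x - expec p s G x.
Proof. by elim: s F G => [//|j s IH] F G /=; rewrite -IH avgB. Qed.

Lemma expecZ p s c F x :
  expec p s (fun x => c * F x) x = c * expec p s F x.
Proof.
elim: s F => [//|j s IH] F /=; rewrite -IH; congr (expec _ _ _ x).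
by apply/funext => y; rewrite /avg meanZ.
Qed.

Lemma diff_form_at_avg p w j F : is_weight p ->
  avg p j (diff_form_at w j F) = diff_form_at w j F.
Proof.
move=> hp; apply: avg_id => // k x; rewrite /diff_form_at.
by congr diff_form; apply/funext => l; rewrite upd_upd.
Qed.

Lemma avg_diff_form_at p w i j F x : i != j ->
  avg p i (diff_form_at w j F) x =
  \sum_k \sum_l w k l *
     mean p (fun a => (F (upd i a (upd j k x)) - F (upd i a (upd j l x))) ^+ 2).
Proof.
move=> ij; rewrite /avg /diff_form_at /diff_form /mean.
under eq_bigr do rewrite mulr_sumr.
rewrite exchange_big; apply: eq_bigr => k _.
under eq_bigr do rewrite mulr_sumr.
rewrite exchange_big; apply: eq_bigr => l _.
rewrite mulr_sumr; apply: eq_bigr => a _.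
by rewrite mulrCA !(updC _ _ _ ij).
Qed.

(** Taking the [L^2] norm in one coordinate does not increase the energy along another, by
    [sqrt_mean_dist] for each pair of letters. *)
Lemma diff_form_at_sqrt_avg p w i j F x : is_weight p ->
  (forall k l, 0 <= w k l) -> i != j ->
  diff_form_at w j (fun x => Num.sqrt (avg p i (fun x => F x ^+ 2) x)) x
  <= avg p i (diff_form_at w j F) x.
Proof.
move=> hp w0 ij; rewrite avg_diff_form_at//.
apply: ler_sum => k _; apply: ler_sum => l _.
by rewrite ler_wpM2l// sqrt_mean_dist.
Qed.

(** For each pair of letters in coordinate [j], this splits a second moment over coordinate [i] into
    variance and squared mean. *)
Lemma diff_form_at_pythagoras p w i j F x : is_weight p -> i != j ->
  avg p i (diff_form_at w j (fun x => F x - avg p i F x)) x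
  + diff_form_at w j (avg p i F) x = avg p i (diff_form_at w j F) x.
Proof.
move=> hp ij; rewrite !avg_diff_form_at// /diff_form_at /diff_form -big_split/=.
apply: eq_bigr => k _; rewrite -big_split/=; apply: eq_bigr => l _.
rewrite -mulrDr; congr (_ * _); cbv beta.
have avgE a y : avg p i F (upd i a y) = avg p i F y.
  by rewrite /avg; congr mean; apply/funext => b; rewrite upd_upd.
set y := upd j k x; set z := upd j l x.
have -> : avg p i F y - avg p i F z = mean p (fun a => F (upd i a y) - F (upd i a z)).
  by rewrite meanB.
set m := mean p (fun a => F (upd i a y) - F (upd i a z)).
have -> : (fun a => (F (upd i a y) - avg p i F (upd i a y)
      - (F (upd i a z) - avg p i F (upd i a z))) ^+ 2) =
    (fun a => (F (upd i a y) - F (upd i a z)) ^+ 2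
       - 2 * m * (F (upd i a y) - F (upd i a z)) + m ^+ 2).
  apply/funext => a; rewrite !avgE.
  have -> : m = avg p i F y - avg p i F z by rewrite /m meanB.
  by ring.
rewrite meanD mean_cst// meanB meanZ -/m; ring.
Qed.

(** Tensorization: apply the one-letter inequality in the coordinate [j], then the induction
    hypothesis to the [L^2] norm [G] of [F] in that coordinate. *)
Lemma expec_logSobolev p w s F x : is_weight p ->
  (forall k l, 0 <= w k l) ->
  (forall g, mean p (fun i => xlnx (g i ^+ 2))
            - xlnx (mean p (fun i => g i ^+ 2)) <= diff_form w g) ->
  uniq s ->
  expec p s (fun x => xlnx (F x ^+ 2)) x - xlnx (expec p s (fun x => F x ^+ 2) x)
  <= \sum_(j <- s) expec p s (diff_form_at w j F) x.
Proof.
move=> hp w0 hw; elim: s F => [|j s IH] F /=.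
  by move=> _; rewrite subrr big_nil.
move=> /andP[js us].
pose G x := Num.sqrt (avg p j (fun x => F x ^+ 2) x).
have GE : avg p j (fun x => F x ^+ 2) = fun x => G x ^+ 2.
  apply/funext => y; rewrite sqr_sqrtr//; apply: avg_ge0 => // z; exact: sqr_ge0.
rewrite big_cons GE diff_form_at_avg//.
have h1 : expec p s (avg p j (fun x => xlnx (F x ^+ 2))) x
    - expec p s (fun x => xlnx (G x ^+ 2)) x <= expec p s (diff_form_at w j F) x.
  rewrite -expecB; apply: expec_le => // y.
  have := hw (fun k => F (upd j k y)); rewrite /diff_form_at.
  have := GE; move=> /(congr1 (fun f => f y)) <-; exact.
have h2 := IH G us.
have h3 : \sum_(k <- s) expec p s (diff_form_at w k G) x
    <= \sum_(k <- s) expec p s (avg p j (diff_form_at w k F)) x.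
  rewrite big_seq [leRHS]big_seq; apply: ler_sum => k ks.
  apply: expec_le => // y; apply: diff_form_at_sqrt_avg => //.
  by apply: contraNneq js => ->.
by lra.
Qed.

(** A function whose [L^1] norm is small compared with its [L^2] norm has large entropy. The free
    parameter [t] makes the bound linear in both norms, hence summable over martingale differences;
    it is [c^-1] in the application. *)
Lemma expec_entropy_ge p s F x t al : is_weight p -> 0 < t ->
  (forall x, `|F x| <= 1) -> expec p s (fun x => `|F x|) x <= al ->
  (1 + ln t) * expec p s (fun x => F x ^+ 2) x
   - t * al * expec p s (fun x => `|F x|) x
  <= expec p s (fun x => xlnx (F x ^+ 2)) x - xlnx (expec p s (fun x => F x ^+ 2) x).
Proof.
move=> hp t0 F1; set a := expec p s (fun x => `|F x|) x.
set b := expec p s (fun x => F x ^+ 2) x; set e := expec p s _ x => aal.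
have b0 : 0 <= b by apply: expec_ge0 => // y; exact: sqr_ge0.
have a0 : 0 <= a by apply: expec_ge0.
have ba : b <= a.
  apply: expec_le => // y; rewrite -real_normK ?num_real// expr2 ler_piMr//.
have tangent u : 0 < u -> 2 * b * (1 + ln u) - 2 * u * a <= e.
  move=> u0; rewrite mulrAC -!expecZ -expecB; apply: expec_le => // y.
  have := xlnx_tangent u0 (normr_ge0 (F y)).
  rewrite -(real_normK (num_real (F y))) /xlnx.
  have := normr_ge0 (F y); rewrite le_eqVlt => /predU1P[<-|F0].
    by rewrite expr0n/= !mulr0 !mul0r subr0.
  by rewrite lnXn// -mulr_natr; nra.
have tala : t * a * a <= t * al * a by rewrite ler_wpM2r// ler_wpM2l// ltW.
move: b0; rewrite le_eqVlt => /predU1P[b0|b0].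
  rewrite -b0 /xlnx mulr0 mul0r sub0r subr0.
  move: a0; rewrite le_eqVlt => /predU1P[a0|a0].
    by have := tangent 1 ltr01; rewrite -b0 -a0; lra.
  have := tangent (t * a / 2); rewrite divr_gt0 ?mulr_gt0// => /(_ isT).
  by rewrite -b0; lra.
have a_gt0 : 0 < a by apply: lt_le_trans ba.
(* The best tangent point: it gives [e >= 2 b ln (b / a)], hence an entropy of at least
   [b ln (b / a^2)]. *)
have := tangent (b / a) (divr_gt0 b0 a_gt0).
have taab : 0 < t * (a * a / b) by rewrite mulr_gt0// divr_gt0// mulr_gt0.
have := ln_le_subr1 taab.
have aa0 : 0 < a * a by rewrite mulr_gt0.
rewrite (@lnM _ t) ?posrE ?divr_gt0// (@ln_div _ (a * a)) ?posrE// (@ln_div _ b) ?posrE//.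
rewrite (@lnM _ a) ?posrE//.
rewrite -(ler_pM2l b0) !mulrBr !mulrDr.
have -> : b * (t * (a * a / b)) = t * a * a by field; rewrite gt_eqF.
have -> : 2 * (b / a) * a = 2 * b by field; rewrite gt_eqF.
by rewrite /xlnx; lra.
Qed.

(* Falik-Samorodnitsky: the martingale differences of [F] along [s] are
   obtained by averaging out one coordinate at a time, and the logarithmic
   Sobolev inequality is applied to each of them. *)
Lemma expec_Falik_Samorodnitsky p w s F x t al : is_weight p ->
  (forall k l, 0 <= w k l) ->
  (forall g, mean p (fun i => xlnx (g i ^+ 2))
            - xlnx (mean p (fun i => g i ^+ 2)) <= diff_form w g) ->
  uniq s -> 0 < t -> 0 <= al -> (forall x, 0 <= F x <= 1) ->
  (forall j, j \in s -> expec p s (fun x => `|F x - avg p j F x|) x <= al) ->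
  (1 + ln t) * (expec p s (fun x => F x ^+ 2) x - expec p s F x ^+ 2)
  - t * al * \sum_(j <- s) expec p s (fun x => `|F x - avg p j F x|) x
  <= \sum_(j <- s) expec p s (diff_form_at w j F) x.
Proof.
move=> hp w0 hw + t0 al0; elim: s F => [|j s IH] F /=.
  by move=> _ _ _; rewrite !big_nil subrr !mulr0 subrr.
move=> /andP[js us] F01 Fal; rewrite !big_cons.
(* [V] is the first martingale difference; the others are those of [G]. *)
pose G := avg p j F; pose V x := F x - G x.
have G01 y : 0 <= G y <= 1.
  apply/andP; split; first by apply: avg_ge0 => // z; have /andP[] := F01 z.
  rewrite -(mean_cst 1 hp); apply: mean_le => // k.
  by have /andP[] := F01 (upd j k y).
have V1 y : `|V y| <= 1.
  by rewrite ler_norml; have := F01 y; have := G01 y; rewrite /V; lra.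
(* Averaging over [j] contracts deviations along the other coordinates, so the bound [al] passes
   from [F] to [G]. *)
have GV k y : `|G y - avg p k G y| <= avg p j (fun x => `|F x - avg p k F x|) y.
  rewrite /G avgC -/(avg p j _ y) -[X in `|X|]/((fun z => avg p j F z - avg p j (avg p k F) z) y).
  rewrite -avgB; apply: le_trans (ler_norm_sum _ _ _) _; apply: ler_sum => l _.
  by case: hp => p0 _; rewrite normrM ger0_norm.
have sumGV : \sum_(k <- s) expec p s (fun x => `|G x - avg p k G x|) x <=
    \sum_(k <- s) expec p s (avg p j (fun x => `|F x - avg p k F x|)) x.
  by apply: ler_sum => k _; apply: expec_le.
have ih := IH G us G01 _.
have {ih}ih := ih (fun k ks => le_trans (expec_le _ _ hp (GV k))
  (Fal k ltac:(by rewrite in_cons ks orbT))).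
have Vent := @expec_entropy_ge p (j :: s) V x t al hp t0 V1 (Fal j (mem_head _ _)).
have := @expec_logSobolev p w (j :: s) V x hp w0 hw.
rewrite /= js us => /(_ isT) Vsob.
have Vsqr : expec p s (avg p j (fun x => V x ^+ 2)) x =
    expec p s (avg p j (fun x => F x ^+ 2)) x - expec p s (fun x => G x ^+ 2) x.
  rewrite -expecB; congr (expec _ _ _ x); apply/funext => y.
  rewrite /avg /V.
  have GE k : G (upd j k y) = G y.
    by rewrite /G /avg; congr mean; apply/funext => l; rewrite upd_upd.
  rewrite (_ : (fun k => (F _ - _) ^+ 2) = fun k => F (upd j k y) ^+ 2
     - 2 * G y * F (upd j k y) + G y ^+ 2); last first.
    by apply/funext => k; rewrite GE; ring.
  rewrite meanD mean_cst// meanB meanZ -/(avg p j F y) -/(G y); ring.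
(* Subtracting [G], which ignores coordinate [j], does not change the energy along [j]. *)
have formj : diff_form_at w j V = diff_form_at w j F.
  apply/funext => y; rewrite /diff_form_at /diff_form.
  apply: eq_bigr => k _; apply: eq_bigr => l _.
  have GE a : G (upd j a y) = G y.
    by rewrite /G /avg; congr mean; apply/funext => b; rewrite upd_upd.
  by rewrite /V !GE; congr (_ * _ ^+ 2); ring.
(* Along the remaining coordinates the energy of [F] splits exactly between [V] and [G], so nothing
   is counted twice. *)
have formk : \sum_(k <- s) expec p s (avg p j (diff_form_at w k V)) x
    + \sum_(k <- s) expec p s (diff_form_at w k G) x =
    \sum_(k <- s) expec p s (avg p j (diff_form_at w k F)) x.
  rewrite -big_split/= big_seq [RHS]big_seq; apply: eq_bigr => k ks.
  rewrite -expecD; congr (expec _ _ _ x); apply/funext => y.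
  by rewrite diff_form_at_pythagoras//; apply: contraNneq js => ->.
move: Vent Vsob ih; rewrite big_cons/= Vsqr formj -/G -/V.
have := ler_wpM2l (mulr_ge0 (ltW t0) al0) sumGV.
move: formk.
set A1 := \sum_(k <- s) _; set A2 := \sum_(k <- s) _; set A3 := \sum_(k <- s) _.
lra.
Qed.

Definition osc (j : nat) F : T -> R :=
  fun x => F (upd j ord_max x) - F (upd j ord0 x).

Definition nondecr_fun F := forall x y : T, (forall j, (x j <= y j)%N) -> F x <= F y.

Lemma nondecr_coord F j x : nondecr_fun F -> nondecr (fun k => F (upd j k x)).
Proof.
by move=> hF k l kl; apply: hF => i; rewrite /upd; case: (i == j).
Qed.

Lemma osc_ge0 F j x : nondecr_fun F -> 0 <= osc j F x.
Proof. by move=> hF; rewrite subr_ge0; exact: (nondecr_coord j x hF). Qed.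

Lemma expec_avg p j s F x : is_weight p -> j \in s ->
  expec p s (avg p j F) x = expec p s F x.
Proof.
move=> hp; elim: s F => [//|i s IH] F /=; rewrite in_cons.
have [->|ij/=] := eqVneq j i; first by rewrite avg_avg.
by move=> js; rewrite avgC IH.
Qed.

(** Let [L = - ln c], and let [V] be the variance and [J] the total influence. Falik-Samorodnitsky
    with [t = c^-1] and [al = 2 * g] gives [(1 + L) V - g J / c <= J]. If [J < L V], the correction
    [g J / c] is at most [g L V / c <= V], which gives back [L V <= J]. *)
Lemma total_influence_ge p s F x g c : is_weight p -> uniq s ->
  nondecr_fun F -> (forall x, 0 <= F x <= 1) -> 0 <= g -> 0 < c < 1 ->
  g <= c -> g * - ln c <= c ->
  (forall j, j \in s -> expec p s (fun x => F x - F (upd j ord0 x)) x <= g) ->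
  - ln c * (expec p s (fun x => F x ^+ 2) x - expec p s F x ^+ 2)
    <= \sum_(j <- s) expec p s (osc j F) x.
Proof.
move=> hp us hF F01 g0 /andP[c0 c1] gc gLc Fg.
set J := \sum_(j <- s) _; set V := _ - _; set L := - ln c.
have L0 : 0 < L by rewrite oppr_gt0 ln_lt0// c0.
have J0 : 0 <= J.
  by apply: sumr_ge0 => j _; apply: expec_ge0 => // y; exact: osc_ge0.
have dev j y : avg p j (fun x => `|F x - avg p j F x|) y =
    mean p (fun k => `|F (upd j k y) - mean p (fun k => F (upd j k y))|).
  rewrite /avg; congr mean; apply/funext => k; congr (`|_ - mean p _|).
  by apply/funext => l; rewrite upd_upd.
have bds j y : forall k, F (upd j ord0 y) <= F (upd j k y) <= F (upd j ord_max y).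
  by move=> k; rewrite !(nondecr_coord j y hF)//= -ltnS.
have dev1 j : j \in s ->
    expec p s (fun x => `|F x - avg p j F x|) x <= 2 * g.
  move=> js; have := Fg _ js.
  rewrite -(expec_avg _ _ hp js) -[X in X <= 2 * g](expec_avg _ _ hp js) => h.
  apply: (@le_trans _ _ (2 * expec p s (avg p j (fun x => F x - F (upd j ord0 x))) x)).
    rewrite -expecZ; apply: expec_le => // y; rewrite dev.
    have [_] := mean_abs_dev_le_half hp (bds j y).
    rewrite /avg meanB (_ : (fun k => F (upd j ord0 (upd j k y))) = fun=> F (upd j ord0 y)).
      by rewrite mean_cst.
    by apply/funext => k; rewrite upd_upd.
  by rewrite ler_pM2l.
have dev2 : \sum_(j <- s) expec p s (fun x => `|F x - avg p j F x|) x <= J / 2.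
  rewrite /J mulr_suml big_seq [leRHS]big_seq; apply: ler_sum => j js.
  rewrite -(expec_avg _ _ hp js) mulrC -expecZ; apply: expec_le => // y.
  by rewrite dev mulrC; have [] := mean_abs_dev_le_half hp (bds j y).
have main : (1 + L) * V - g * J / c <= J.
  suff h e : 0 < e -> (1 + L) * V - g * J / c <= (1 + e) * J.
    rewrite leNgt; apply/negP => JA; set A := (X in J < X) in JA.
    (* With this [e], the term [e * J] is at most half of the gap [A - J]. *)
    have := h ((A - J) / (2 * (J + 1))); rewrite -/A divr_gt0 ?subr_gt0 ?mulr_gt0//; last lra.
    move=> /(_ isT); rewrite mulrDl mul1r.
    have : (A - J) / (2 * (J + 1)) * J <= (A - J) / 2.
      rewrite (_ : _ * J = (A - J) / 2 * (J / (J + 1))); last by field; rewrite gt_eqF//; lra.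
      by rewrite ler_piMr ?divr_ge0 ?subr_ge0 ?ltW// ltr_pdivrMr; lra.
    by lra.
  move=> e0; have [w [w0 _ hw wC]] := logSobolev_form_exists hp e0.
  have := @expec_Falik_Samorodnitsky p w s F x c^-1 (2 * g) hp w0 hw us _ _ F01 dev1.
  rewrite invr_gt0 c0 mulr_ge0// lnV ?posrE// -/V -/L => /(_ isT isT) h.
  have h1 : \sum_(j <- s) expec p s (diff_form_at w j F) x <= (1 + e) * J.
    rewrite mulr_sumr; apply: ler_sum => j _; rewrite -expecZ; apply: expec_le => // y.
    by apply: diff_form_nondecr_le => //; exact: nondecr_coord.
  have : c^-1 * (2 * g) * \sum_(j <- s) expec p s (fun x => `|F x - avg p j F x|) x
     <= c^-1 * (2 * g) * (J / 2).
    by rewrite ler_wpM2l// mulr_ge0 ?mulr_ge0// invr_ge0 ltW.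
  have -> : c^-1 * (2 * g) * (J / 2) = g * J / c by field; rewrite gt_eqF.
  lra.
rewrite leNgt; apply/negP => JV.
have : g * J / c <= V.
  rewrite ler_pdivrMr//; apply: (@le_trans _ _ (g * (L * V))).
    by rewrite ler_wpM2l// ltW.
  rewrite mulrA mulrC ler_wpM2l//.
  by have := le_lt_trans J0 JV; rewrite pmulr_rgt0// => /ltW.
by lra.
Qed.

End product_expectation.

(** * Comparing product expectations under two letter distributions *)

Section varying_the_weight.
Context {R : realType} {n : nat}.
Notation X := (letter n).
Notation T := (nat -> X).
Implicit Types (p q : X -> R) (F : T -> R) (s : seq nat) (x : T).

Lemma avg_nondecr p j F : is_weight p -> nondecr_fun F -> nondecr_fun (avg p j F).
Proof.
move=> hp hF x y xy; apply: mean_le => // k; apply: hF => i.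
by rewrite /upd; case: (i == j).
Qed.

Lemma expec_dominated p q s F x : is_weight p -> is_weight q ->
  (forall m, mean p (up m) <= mean q (up m)) -> nondecr_fun F ->
  expec p s F x <= expec q s F x.
Proof.
move=> hp hq pq; elim: s F => [//|j s IH] F hF /=.
apply: le_trans (IH _ (avg_nondecr j hq hF)).
apply: expec_le => // y; rewrite /avg !(@mean_abel _ _ _ (fun k => F (upd j k y)))// lerD2l.
apply: ler_sum => m _; rewrite ler_wpM2l//.
exact: (nondecr_incr m (nondecr_coord j y hF)).
Qed.

(** Every threshold gains at least [d], and the coefficients of the threshold decomposition add up
    to the oscillation. *)
Lemma avg_increment p q d j F x : is_weight p -> is_weight q ->
  (forall m, (0 < m <= n)%N -> mean p (up m) + d <= mean q (up m)) ->
  nondecr_fun F -> avg p j F x + d * osc j F x <= avg q j F x.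
Proof.
move=> hp hq pq hF; rewrite /avg !(@mean_abel _ _ _ (fun k => F (upd j k x)))//.
rewrite /osc -(abel_ord_max (fun k => F (upd j k x))) -addrA lerD2l mulr_sumr -big_split/=.
apply: ler_sum => m _.
have h0 := nondecr_incr m (nondecr_coord j x hF).
by have := ler_wpM2l h0 (pq m.+1 (ltn_ord m)); rewrite mulrDr [_ * d]mulrC.
Qed.

Lemma osc_avg p k j F : k != j -> osc k (avg p j F) = avg p j (osc k F).
Proof.
move=> kj; apply/funext => x; rewrite /osc avgB /avg /=.
by congr (_ - _); congr mean; apply/funext => l; rewrite updC// eq_sym.
Qed.

(** A discrete Russo formula: letters are switched from [p] to [q] one at a time. The influence of a
    letter is then seen under a mixture of both weights; going back to [p] costs a factor [e] for
    each letter already switched. *)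
Lemma expec_increment p q d e s F x : is_weight p -> is_weight q -> uniq s ->
  0 <= d -> 0 <= e <= 1 -> (forall i, e * p i <= q i) ->
  (forall m, (0 < m <= n)%N -> mean p (up m) + d <= mean q (up m)) ->
  nondecr_fun F ->
  expec p s F x + d * e ^+ size s * \sum_(j <- s) expec p s (osc j F) x
  <= expec q s F x.
Proof.
move=> hp hq us d0 /andP[e0 e1] epq pq; elim: s us F => [|j s IH]/=.
  by move=> _ F _; rewrite big_nil mulr0 addr0.
move=> /andP[js us] F hF; rewrite big_cons.
have := IH us _ (avg_nondecr j hq hF).
have h1 : expec p s (avg p j F) x + d * expec p s (avg p j (osc j F)) x
    <= expec p s (avg q j F) x.
  rewrite (@avg_id _ _ p j (osc j F))//; last first.
    by move=> k y; rewrite /osc !upd_upd.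
  by rewrite -expecZ -expecD; apply: expec_le => // y; exact: avg_increment.
have h2 : e * \sum_(k <- s) expec p s (avg p j (osc k F)) x
    <= \sum_(k <- s) expec p s (osc k (avg q j F)) x.
  rewrite mulr_sumr big_seq [leRHS]big_seq; apply: ler_sum => k ks.
  rewrite -expecZ osc_avg; last by apply: contraNneq js => <-.
  apply: expec_le => // y; rewrite -meanZ; apply: ler_sum => l _.
  by rewrite mulrCA mulrA ler_wpM2r// osc_ge0.
have oscj0 : 0 <= expec p s (avg p j (osc j F)) x.
  by apply: expec_ge0 => // y; apply: avg_ge0 => // z; exact: osc_ge0.
move: h1 h2 oscj0; set A := expec p s (avg p j (osc j F)) x.
set B := \sum_(k <- s) _; set C := \sum_(k <- s) _ => h1 h2 A0 h3.
have es0 : 0 <= e ^+ size s by rewrite exprn_ge0.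
have es1 : e * e ^+ size s <= 1 by rewrite -exprS exprn_ile1.
have : d * (e * e ^+ size s) * A <= d * A.
  by rewrite -mulrA ler_wpM2l// ler_piMl.
have : d * e ^+ size s * (e * B) <= d * e ^+ size s * C.
  by rewrite ler_wpM2l// mulr_ge0.
rewrite exprS; lra.
Qed.

End varying_the_weight.

(** * Comparison of a monotone function with the logistic equation *)

Section logistic_growth.
Context {R : realType}.
Implicit Types (g : R -> R).

(* The lower right Dini derivative of [g] is at least [K * g * (1 - g)]; jumps
   of [g] are upwards, so that no continuity is needed. *)
Definition logistic_at g (K t2 s : R) := forall k, k < K * (g s * (1 - g s)) ->
  exists2 d, 0 < d & forall t, s < t < s + d -> t <= t2 -> k * (t - s) <= g t - g s.

(** The inequality says that the odds [g / (1 - g)] grow at least like [expR (K' * t)]. The supremum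
    of the times at which it holds is one of them, and were it below [t2] it could be pushed to the
    right; the gap between [K'] and [K] absorbs second-order terms. *)
Lemma logistic_growth_strict g t1 t2 K K' : t1 <= t2 -> 0 <= K' < K ->
  (forall s t, t1 <= s -> s <= t -> t <= t2 -> g s <= g t) ->
  0 < g t1 -> g t2 < 1 ->
  (forall s, t1 <= s < t2 -> logistic_at g K t2 s) ->
  g t1 * (1 - g t2) * expR (K' * (t2 - t1)) <= g t2 * (1 - g t1).
Proof.
move=> t12 /andP[K'0 K'K] gm g1 g2 gK.
pose E := [set t | t1 <= t <= t2 /\
  g t1 * (1 - g t) * expR (K' * (t - t1)) <= g t * (1 - g t1)].
have E1 : E t1.
  by split; rewrite ?lexx// subrr mulr0 expR0 mulr1.
have supE : has_sup E by split; [exists t1|exists t2 => t [/andP[]]].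
set S := sup E.
have t1S : t1 <= S by apply: sup_upper_bound.
have St2 : S <= t2 by apply: sup_le_ub; [exists t1|move=> t [/andP[]]].
have bds t : t1 <= t <= t2 -> 0 < g t < 1.
  by move=> /andP[h1 h2]; have := gm _ _ (lexx _) h1 h2; have := gm _ _ h1 h2 (lexx _); lra.
have g1b := bds t1 ltac:(by rewrite lexx).
have gSb := bds S ltac:(by rewrite t1S).
(* Passing to the limit from the left uses only [g t <= g S] and the continuity of the
   exponential. *)
have ES : E S.
  split; first by rewrite t1S.
  set A := g t1 * (1 - g S) * _.
  have A0 : 0 <= A by rewrite mulr_ge0 ?expR_ge0// mulr_ge0//; lra.
  apply/ler_addgt0Pr => e e0.
  have de : 0 < e / (A * K' + 1) by rewrite divr_gt0// ltr_wpDl// mulr_ge0.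
  have [t Et St] := sup_adherent de supE.
  have tS : t <= S by apply: sup_upper_bound.
  case: Et => /andP[t1t tt2] Et.
  have gtS := gm _ _ t1t tS St2.
  have h1 : g t * (1 - g t1) <= g S * (1 - g t1) by rewrite ler_wpM2r//; lra.
  have h2 : A * (1 - K' * (S - t)) <= g t1 * (1 - g t) * expR (K' * (t - t1)).
    have -> : K' * (t - t1) = K' * (S - t1) + - (K' * (S - t)) by ring.
    rewrite expRD mulrA; apply: (@le_trans _ _ (A * expR (- (K' * (S - t))))).
      by rewrite ler_wpM2l// expR_ge1Dx.
    rewrite ler_wpM2r ?expR_ge0// ler_wpM2r ?expR_ge0// ler_wpM2l//; lra.
  have h3 : A * K' * (S - t) <= e.
    apply: (@le_trans _ _ ((A * K' + 1) * (e / (A * K' + 1)))).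
      by apply: ler_pM; rewrite ?mulr_ge0//; rewrite -?/S in St *; lra.
    by rewrite mulrCA divff ?mulr1// gt_eqF// ltr_wpDl// mulr_ge0.
  by lra.
move: (St2); rewrite le_eqVlt => /predU1P[<-|Slt]; first by case: ES.
exfalso.
set a := g S in gSb; pose K2 := (K + K') / 2.
have a1a : 0 < a * (1 - a) by rewrite mulr_gt0//; lra.
have [d d0 gd] := gK S ltac:(by rewrite t1S) (K2 * (a * (1 - a)))
  ltac:(by rewrite ltr_pM2r// /K2; lra).
have K20 : 0 < K2 by rewrite /K2; lra.
(* The last bound controls the second-order term [K' * K2 * u]; the added 1 keeps the denominator
   positive when [K' = 0]. *)
pose u := Num.min (d / 2) (Num.min (t2 - S) ((K2 - K') / (K' * K2 + 1))).
have KK0 : 0 <= K' * K2 by rewrite mulr_ge0// ltW.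
have u0 : 0 < u.
  rewrite /u !lt_min; apply/and3P; split; [lra|lra|].
  by apply: divr_gt0; [rewrite /K2|]; lra.
have [ud uS uK] : [/\ u <= d / 2, u <= t2 - S & u <= (K2 - K') / (K' * K2 + 1)].
  by split; rewrite /u !ge_min lexx ?orbT.
have := gd (S + u) ltac:(lra) ltac:(lra).
have -> : S + u - S = u by ring.
rewrite -/a => gu.
have t1Su : t1 <= S + u by lra.
have Sut2 : S + u <= t2 by lra.
have gb := bds (S + u) ltac:(by rewrite t1Su).
suff : E (S + u) by move=> /(sup_upper_bound supE); rewrite -/S; lra.
split; first by rewrite t1Su.
have -> : K' * (S + u - t1) = K' * (S - t1) + K' * u by ring.
rewrite expRD; case: ES => _; rewrite -/a.
set b := g (S + u) in gu gb *; set e1 := expR (K' * (S - t1)).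
set e2 := expR (K' * u) => ES.
have e20 : 0 < e2 by exact: expR_gt0.
have K'u : (1 - K' * u) * e2 <= 1.
  have := @expR_ge1Dx R (- (K' * u)); rewrite expRN -/e2 => h.
  by rewrite -ler_pdivlMr// mul1r.
have KKu : (K' * K2 + 1) * u <= K2 - K'.
  by rewrite mulrC -ler_pdivlMr// ltr_wpDl.
(* Over a time [u] the odds are multiplied by at least [(1 + K2 (1 - a) u) / (1 - K2 a u)]; this
   factor must beat [e2]. *)
have step : (1 - K2 * a * u) * e2 <= 1 + K2 * (1 - a) * u.
  have h0 : 0 <= 1 + K2 * (1 - a) * u.
    by rewrite addr_ge0// mulr_ge0 ?mulr_ge0 ?ltW//; lra.
  apply: (@le_trans _ _ ((1 + K2 * (1 - a) * u) * ((1 - K' * u) * e2))); last first.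
    by rewrite ler_piMr.
  rewrite mulrA ler_pM2r//.
  have : K' * K2 * u * ((1 - a) * u) <= (K2 - K') * u.
    apply: (@le_trans _ _ (K' * K2 * u * u)); last by rewrite ler_wpM2r//; lra.
    rewrite ler_wpM2l// ?mulr_ge0// ?ltW//; nra.
  by lra.
have step2 : (1 - b) * a * e2 <= b * (1 - a).
  apply: (@le_trans _ _ ((a * (1 - a)) * ((1 - K2 * a * u) * e2))).
    rewrite [leRHS]mulrA ler_pM2r//.
    have -> : a * (1 - a) * (1 - K2 * a * u) = ((1 - a) - K2 * (a * (1 - a)) * u) * a by ring.
    by rewrite ler_wpM2r//; lra.
  apply: (@le_trans _ _ ((a * (1 - a)) * (1 + K2 * (1 - a) * u))).
    by rewrite ler_wpM2l// ltW.
  have -> : a * (1 - a) * (1 + K2 * (1 - a) * u) = (a + K2 * (a * (1 - a)) * u) * (1 - a) by ring.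
  by rewrite ler_wpM2r//; lra.
have a1 : 0 < 1 - a by lra.
rewrite -(ler_pM2r a1).
have h1 : (1 - b) * e2 * (g t1 * (1 - a) * e1) <= (1 - b) * e2 * (a * (1 - g t1)).
  by rewrite ler_wpM2l// mulr_ge0// ?ltW//; lra.
have h2 : (1 - b) * a * e2 * (1 - g t1) <= b * (1 - a) * (1 - g t1).
  by rewrite ler_wpM2r//; lra.
lra.
Qed.

Lemma logistic_growth g t1 t2 K : t1 <= t2 -> 0 <= K ->
  (forall s t, t1 <= s -> s <= t -> t <= t2 -> g s <= g t) ->
  (forall t, t1 <= t <= t2 -> 0 <= g t <= 1) ->
  (forall s, t1 <= s < t2 -> logistic_at g K t2 s) ->
  g t1 * (1 - g t2) <= expR (- (K * (t2 - t1))).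
Proof.
move=> t12 K0 gm g01 gK.
have /andP[g10 g11] := g01 t1 ltac:(by rewrite lexx).
have /andP[g20 g21] := g01 t2 ltac:(by rewrite lexx t12).
have := expR_gt0 (- (K * (t2 - t1))).
move: (g10); rewrite le_eqVlt => /predU1P[<-|h1]; first by rewrite mul0r => /ltW.
move: (g21); rewrite le_eqVlt => /predU1P[->|h2]; first by rewrite subrr mulr0 => /ltW.
move=> _; set B := g t1 * (1 - g t2).
have B0 : 0 < B by rewrite mulr_gt0//; lra.
have B1 : B <= 1 by rewrite /B mulr_ile1//; lra.
rewrite leNgt; apply/negP => KB.
have lnB : - (K * (t2 - t1)) < ln B.
  by rewrite -ltr_expR lnK ?posrE.
have lnB0 : ln B <= 0 by exact: ln_le0.
have D0 : 0 < t2 - t1.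
  by have := K0; rewrite le_eqVlt => /predU1P[K00|Kgt]; [move: lnB; rewrite -K00; lra|nra].
(* The midpoint of [K] and [- ln B / (t2 - t1)], the latter being smaller than [K] by assumption. *)
pose K' := K - (ln B + K * (t2 - t1)) / (2 * (t2 - t1)).
have K'D : K' * (t2 - t1) = (K * (t2 - t1) - ln B) / 2.
  by rewrite /K'; field; rewrite gt_eqF.
have K'0 : 0 <= K' by rewrite -(pmulr_lge0 _ D0) K'D; nra.
have K'K : K' < K by rewrite -(ltr_pM2r D0) K'D; lra.
have := @logistic_growth_strict g t1 t2 K K' t12 _ gm h1 h2 gK.
rewrite K'0 K'K -/B => /(_ isT) h3.
have : B * expR (K' * (t2 - t1)) <= 1.
  by apply: (le_trans h3); rewrite mulr_ile1//; lra.
move=> /ln_le0; rewrite lnM ?posrE ?expR_gt0// expRK K'D; lra.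
Qed.

End logistic_growth.

(** * Rectangles, measurability and integration over one coordinate *)

Section resampling.
Context {R : realType} {n : nat}.
Notation X := (letter n).
Notation T := (nat -> X).

Definition weight (mu : probability X R) : X -> R := fun k => fine (mu [set k]).

Lemma fine_letter_set (mu : probability X R) (B : set X) :
  fine (mu B) = mean (weight mu) (\1_B).
Proof.
have BE : B = \big[setU/set0]_(k < n.+1 | k \in B) [set k].
  apply/seteqP; split=> [k Bk|].
    by rewrite (bigD1 k)/=; [left|rewrite inE].
  by elim/big_ind : _ => [//|U V UB VB k [/UB|/VB]//|k kB _ ->]; rewrite inE in kB.
rewrite [in LHS]BE (@measure_bigsetU_ord_cond _ _ _ mu)//; last first.
  by apply/trivIsetP => i j _ _ ij; rewrite -subset0 => k [/= -> /eqP]; rewrite (negbTE ij).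
rewrite -sum_fine//; last by move=> k _; exact: fin_num_measure.
rewrite /mean big_mkcond; apply: eq_bigr => k _.
by rewrite indicE; case: (k \in B); rewrite ?mulr1 ?mulr0.
Qed.

Lemma weightP (mu : probability X R) : is_weight (weight mu).
Proof.
split=> [i|]; first exact: fine_ge0.
have := fine_letter_set mu setT; rewrite probability_setT/= => ->.
by apply: eq_bigr => i _; rewrite indicT/= mulr1.
Qed.

Definition rectangle (m : nat) (B : nat -> set X) : set (config n) :=
  [set x | forall j, (j < m)%N -> B j (x j)].

Lemma measurable_coord (j : nat) (B : set X) :
  measurable [set x : config n | B (x j)].
Proof. by apply: sub_sigma_algebra; exists j, B. Qed.

Lemma measurable_rectangle m B : measurable (rectangle m B).
Proof.
rewrite (_ : rectangle m B = \bigcap_(j in [set j | (j < m)%N]) [set x : config n | B j (x j)]).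
  by apply: bigcap_measurableType => j _; exact: measurable_coord.
by apply/seteqP; split.
Qed.

Lemma measurable_config_rectangle :
  @measurable _ (config n) = <<s [set C | exists m B, C = rectangle m B] >>.
Proof.
rewrite eqEsubset; split.
  apply: smallest_sub; first exact: smallest_sigma_algebra.
  move=> C [j [B ->]]; apply: sub_sigma_algebra.
  exists j.+1, (fun i => if i == j then B else setT).
  apply/seteqP; split => x /=.
    by move=> Bx i _; case: eqP => // ->.
  by move=> /(_ j (ltnSn j)); rewrite eqxx.
apply: smallest_sub; first exact: sigma_algebra_measurable.
by move=> C [m [B ->]]; exact: measurable_rectangle.
Qed.

(** Covers both kinds of surgery on configurations, [upd] and [glue], which copy some coordinates
    and freeze the others. *)
Lemma measurable_coordwise (f : config n -> config n) :
  (forall i, (exists j, forall y, f y i = y j) \/ (exists k, forall y, f y i = k)) ->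
  forall B, measurable B -> measurable (f @^-1` B).
Proof.
move=> fE; apply: smallest_sub.
  split.
  - by rewrite /= preimage_set0.
  - by move=> A mA /=; rewrite setTD preimage_setC; exact: measurableC.
  - by move=> A mA /=; rewrite preimage_bigcup; exact: bigcupT_measurable.
move=> C [i [B ->]] /=; case: (fE i) => [[j h]|[k h]].
  rewrite (_ : _ @^-1` _ = [set x : config n | B (x j)]); first exact: measurable_coord.
  by apply/seteqP; split => y /=; rewrite h.
have [Bk|Bk] := pselect (B k).
  by rewrite (_ : _ @^-1` _ = setT)//; apply/seteqP; split => y //=; rewrite h.
by rewrite (_ : _ @^-1` _ = set0)//; apply/seteqP; split => y //=; rewrite h.
Qed.

Lemma measurable_upd j k (B : set (config n)) : measurable B ->
  measurable [set y : config n | B (upd j k y)].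
Proof.
apply: (@measurable_coordwise (upd j k)) => i; rewrite /upd.
by case: (i == j); [right; exists k|left; exists i].
Qed.

Lemma measurable_fun_upd j k :
  measurable_fun [set: config n] (upd j k : config n -> config n).
Proof. by move=> _ B mB; rewrite setTI; exact: measurable_upd. Qed.

Lemma prod_rectangle_upd p j m (B : nat -> set X) : (j < m)%N ->
  forall mass : set X -> R, (forall C, mass C = mean p \1_C) ->
  \sum_k p k * (k \in B j)%:R * \prod_(i < m | i != j :> nat) mass (B i)
  = \prod_(i < m) mass (B i).
Proof.
move=> jm mass mE; rewrite -mulr_suml.
by rewrite [RHS](bigD1 (Ordinal jm))//= [in RHS]mE; congr (_ * _).
Qed.

Lemma resample_rectangle mu (nu : probability (config n) R) j m B :
  is_product_measure mu nu -> (j < m)%N ->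
  fine (nu (rectangle m B)) =
  mean (weight mu) (fun k => fine (nu [set y | rectangle m B (upd j k y)])).
Proof.
move=> hnu jm; rewrite hnu/=.
rewrite -(@prod_rectangle_upd (weight mu) j m B jm (fun C => fine (mu C))).
- apply: eq_bigr => k _; rewrite -mulrA; congr (_ * _).
  have [Bk|Bk] := boolP (k \in B j); last first.
    rewrite mul0r (_ : [set _ | _] = set0) ?measure0//.
    apply/seteqP; split => y //= /(_ j jm); rewrite /upd eqxx => h.
    by move: Bk; rewrite notin_setE.
  rewrite mul1r (_ : [set y | _] = rectangle m (fun i => if i == j then setT else B i)).
    rewrite hnu/= big_mkcond; apply: eq_bigr => i _.
    by case: eqP => //= _; rewrite probability_setT.
  apply/seteqP; split => y /= h i im.
    by have := h i im; rewrite /upd; case: eqP.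
  by have := h i im; rewrite /upd; case: eqP => // -> _; rewrite inE in Bk.
- by move=> C; rewrite fine_letter_set.
Qed.

(** Fubini for one coordinate. As a function of [A] the right side is a mixture of pushforwards,
    hence a measure, and it agrees with [nu] on the generating pi-system of rectangles. *)
Lemma resample mu (nu : probability (config n) R) j (A : set (config n)) :
  is_product_measure mu nu -> measurable A ->
  fine (nu A) = mean (weight mu) (fun k => fine (nu [set y | A (upd j k y)])).
Proof.
move=> hnu mA; have [p0 p1] := weightP mu.
have mupd k := @measurable_fun_upd j k.
pose M' (k : nat) : {measure set (config n) -> \bar R} :=
  mscale (NngNum (p0 (inord k))) (pushforward nu (upd j (inord k) : config n -> config n)).
pose M := M' (fun k => mupd (inord k)).
have MfinE B : measurable B -> msum M n.+1 B =
    (mean (weight mu) (fun k => fine (nu [set y | B (upd j k y)])))%:E.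
  move=> mB; rewrite /msum/= -sumEFin; apply: eq_bigr => k _.
  rewrite /M/= /mscale/= /pushforward inord_val EFinM fineK ?fin_num_measure//.
  by rewrite fineK//; apply: fin_num_measure; exact: measurable_upd.
suff -> : nu A = msum M n.+1 A by rewrite MfinE.
apply: (@measure_unique _ _ _ [set C | exists m B, C = rectangle m B] (fun=> setT)) => //.
- exact: measurable_config_rectangle.
- move=> C D [m1 [B1 ->]] [m2 [B2 ->]].
  exists (maxn m1 m2), (fun i => (if (i < m1)%N then B1 i else setT) `&`
    (if (i < m2)%N then B2 i else setT)).
  apply/seteqP; split => [x [/= h1 h2] i _|x /= h].
    by split; case: ifP => //; [exact: h1|exact: h2].
  split=> i im; have := h i; rewrite leq_max im ?orbT => /(_ isT) [].
    by [].
  by [].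
- by move=> _; exists 0%N, (fun=> setT); apply/seteqP; split.
- by rewrite bigcup_const.
- move=> C [m [B ->]]; apply: (etrans _ (esym (MfinE _ (measurable_rectangle m B)))).
  have [jm|mj] := ltnP j m.
    by rewrite -resample_rectangle// fineK//; apply: fin_num_measure; exact: measurable_rectangle.
  rewrite (_ : (fun k => _) = fun=> fine (nu (rectangle m B))).
    by rewrite mean_cst ?fineK//; apply: fin_num_measure; exact: measurable_rectangle.
  apply/funext => k; congr (fine (nu _)).
  apply/seteqP; split => y /= h i im; have := h i im;
    by rewrite /upd; case: eqP => // ij; rewrite ij ltnNge mj in im.
- by move=> _; rewrite -ge0_fin_numE ?fin_num_measure.
Qed.

End resampling.

(** * Cylinders, regularity of the product measure and stochastic domination *)

Section cylinders.
Context {R : realType} {n : nat}.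
Notation X := (letter n).
Notation T := (nat -> X).
Implicit Types (x y z : T) (A C U : set (config n)) (nu : probability (config n) R).

Definition agree (m : nat) x y := forall i, (i < m)%N -> x i = y i.

Definition cylinder (m : nat) C := forall x y, agree m x y -> C x -> C y.

Definition glue (m : nat) x y : T := fun i => if (i < m)%N then x i else y i.

Definition cond_prob nu (m : nat) A : T -> R :=
  fun x => fine (nu [set y : config n | A (glue m x y)]).

(** In decreasing order: the letter of largest index is integrated first, as the induction from
    [cond_prob] at [m.+1] to [cond_prob] at [m] requires. *)
Definition coords (m : nat) : seq nat := rev (iota 0 m).

Lemma coordsS m : coords m.+1 = m :: coords m.
Proof. by rewrite /coords -addn1 iotaD rev_cat add0n. Qed.

Lemma uniq_coords m : uniq (coords m).
Proof. by rewrite rev_uniq iota_uniq. Qed.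

Lemma mem_coords m j : (j \in coords m) = (j < m)%N.
Proof. by rewrite mem_rev mem_iota add0n. Qed.

Lemma measurable_glue m x A : measurable A ->
  measurable [set y : config n | A (glue m x y)].
Proof.
apply: (@measurable_coordwise n (glue m x)) => i; rewrite /glue.
by case: (i < m)%N; [right; exists (x i)|left; exists i].
Qed.

Lemma cond_prob_ge0 nu m A x : 0 <= cond_prob nu m A x.
Proof. exact: fine_ge0. Qed.

Lemma cond_prob_le1 nu m A x : measurable A -> cond_prob nu m A x <= 1.
Proof.
move=> mA; rewrite -lee_fin fineK; first by apply: probability_le1; exact: measurable_glue.
by apply: fin_num_measure; exact: measurable_glue.
Qed.

Lemma cond_prob_nondecr nu m A : measurable A -> increasing A ->
  nondecr_fun (cond_prob nu m A).
Proof.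
move=> mA hA x y xy; apply: fine_le; [by apply: fin_num_measure; exact: measurable_glue..|].
apply: le_measure; rewrite ?inE; [exact: measurable_glue..|].
move=> z /= Az; apply: hA Az _ => i.
by rewrite /glue; case: (i < m)%N.
Qed.

Lemma cond_prob_avg mu nu m A : is_product_measure mu nu -> measurable A ->
  cond_prob nu m A = avg (weight mu) m (cond_prob nu m.+1 A).
Proof.
move=> hnu mA; apply/funext => x.
rewrite /cond_prob (resample m hnu (measurable_glue m x mA)).
congr mean; apply/funext => k; congr (fine (nu _)); apply/seteqP.
suff E y : glue m x (upd m k y) = glue m.+1 (upd m k x) y.
  by split => y /=; rewrite E.
apply/funext => i; rewrite /glue /upd ltnS [(i <= m)%N]leq_eqVlt.
by case: (eqVneq i m) => [->|_] /=; rewrite ?ltnn//; case: (i < m)%N.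
Qed.

Lemma expec_cond_prob mu nu m A x : is_product_measure mu nu -> measurable A ->
  expec (weight mu) (coords m) (cond_prob nu m A) x = fine (nu A).
Proof.
move=> hnu mA; elim: m => [|m IH].
  by rewrite /= /cond_prob; congr (fine (nu _)); apply/seteqP; split.
by rewrite coordsS/= -cond_prob_avg.
Qed.

Lemma cylinder_measurable m C : cylinder m C -> measurable C.
Proof.
elim: m C => [|m IH] C hC.
  have [[x Cx]|C0] := pselect (exists x, C x).
    by rewrite (_ : C = setT)//; apply/seteqP; split => // y _; apply: hC Cx.
  by rewrite (_ : C = set0)//; apply/seteqP; split => // y Cy; apply: C0; exists y.
rewrite (_ : C = \bigcup_(k in [set: X])
   ([set x : config n | [set k] (x m)] `&` [set x | C (upd m k x)])); last first.
  have updE (x : T) : upd m (x m) x = x.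
    by apply/funext => i; rewrite /upd; case: eqP => // ->.
  apply/seteqP; split => [x Cx|x [k _ [/= <-]]]; last by rewrite updE.
  by exists (x m) => //; split => //=; rewrite updE.
apply: fin_bigcup_measurable => [|k _]; first exact: finite_finset.
apply: measurableI; first exact: measurable_coord.
apply: IH => x y xy; apply: hC => i; rewrite ltnS leq_eqVlt /upd.
by case: eqP => //= _; exact: xy.
Qed.

Lemma cylinder_prob mu nu m C x : is_product_measure mu nu -> cylinder m C ->
  expec (weight mu) (coords m) \1_C x = fine (nu C).
Proof.
move=> hnu hC; rewrite -(expec_cond_prob m x hnu (cylinder_measurable hC)).
congr (expec _ _ _ x); apply/funext => y; rewrite indicE /cond_prob.
have [Cy|Cy] := boolP (y \in C).
  rewrite (_ : [set z | _] = setT) ?probability_setT//.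
  apply/seteqP; split => z // _; apply: hC (set_mem Cy) => i im.
  by rewrite /glue im.
rewrite (_ : [set z | _] = set0) ?measure0//.
apply/seteqP; split => z //= Cz; move: Cy; rewrite notin_setE; apply.
by apply: hC Cz => i im; rewrite /glue im.
Qed.

(** Openness for the product of discrete topologies, whose basic open sets fix a finite prefix. *)
Definition open_config U := forall x, U x -> exists m, forall y, agree m x y -> U y.

Definition inner_cylinder (m : nat) U : set (config n) :=
  [set x | forall y, agree m x y -> U y].

Lemma inner_cylinderP m U : cylinder m (inner_cylinder m U).
Proof. by move=> x y xy Ux z yz; apply: Ux => i im; rewrite xy// yz. Qed.

Lemma inner_cylinder_sub m U : inner_cylinder m U `<=` U.
Proof. by move=> x; apply. Qed.

Lemma bigcup_inner_cylinder U : open_config U ->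
  U = \bigcup_m inner_cylinder m U.
Proof.
move=> oU; apply/seteqP; split => [x /oU [m h]|x [m _]]; first by exists m.
exact: inner_cylinder_sub.
Qed.

Lemma nondecreasing_inner_cylinder U :
  nondecreasing_seq (fun m => inner_cylinder m U).
Proof.
move=> k m km; apply/subsetPset => x Ux y xy; apply: Ux => i ik.
by apply: xy; exact: leq_trans ik km.
Qed.

Lemma open_config_measurable U : open_config U -> measurable U.
Proof.
move=> oU; rewrite (bigcup_inner_cylinder oU); apply: bigcupT_measurable => m.
exact: cylinder_measurable (@inner_cylinderP m U).
Qed.

Lemma open_config_bigcup (F : nat -> set (config n)) :
  (forall i, open_config (F i)) -> open_config (\bigcup_i F i).
Proof.
by move=> oF x [i _ Fx]; have [m h] := oF i x Fx; exists m => y /h; exists i.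
Qed.

Lemma open_config_bigcap (F : nat -> set (config n)) (N : nat) :
  (forall i, open_config (F i)) -> open_config (\bigcap_(i < N) F i).
Proof.
move=> oF x Fx; elim: N Fx => [|N IH] Fx; first by exists 0%N => y _ i.
have [m1 h1] := IH (fun i iN => Fx i (ltnW iN)).
have [m2 h2] := oF N x (Fx N (ltnSn N)).
exists (maxn m1 m2) => y xy i /=; rewrite ltnS leq_eqVlt => /orP[/eqP ->|iN].
  by apply: h2 => k km; apply: xy; rewrite leq_max km orbT.
by apply: h1 => // k km; apply: xy; rewrite leq_max km.
Qed.

Definition outer_regular nu A := forall e : R, 0 < e ->
  exists U, [/\ open_config U, A `<=` U & (nu (U `\` A) <= e%:E)%E].

Lemma outer_regular_approx nu (F : nat -> set (config n)) (e : R) : 0 < e ->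
  (forall i, measurable (F i)) -> (forall i, outer_regular nu (F i)) ->
  exists U : nat -> set (config n), [/\ forall i, open_config (U i),
    forall i, F i `<=` U i & (nu (\bigcup_i (U i `\` F i)) <= e%:E)%E].
Proof.
move=> e0 mF rF.
have e2 i : 0 < e / (2 ^ i.+1)%:R by rewrite divr_gt0// ltr0n expn_gt0.
pose U i := sval (cid (rF i _ (e2 i))).
have UP i : [/\ open_config (U i), F i `<=` U i &
    (nu (U i `\` F i) <= (e / (2 ^ i.+1)%:R)%:E)%E].
  exact: (svalP (cid (rF i _ (e2 i)))).
have mUF i : measurable (U i `\` F i).
  by apply: measurableD => //; apply: open_config_measurable; have [] := UP i.
exists U; split=> [i|i|]; [by have [] := UP i|by have [] := UP i|].
apply: le_trans (generalized_Boole_inequality _ mUF _) _.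
  exact: bigcupT_measurable.
apply: le_trans (epsilon_trick0 xpredT (ltW e0)).
by apply: lee_nneseries => // i _; have [] := UP i.
Qed.

(** The sets that are outer regular together with their complement form a sigma-algebra, which
    contains the clopen coordinate sets. *)
Lemma measurable_outer_regular nu A : measurable A -> outer_regular nu A.
Proof.
pose G B := [/\ measurable B, outer_regular nu B & outer_regular nu (~` B)].
suff GP : forall B, measurable B -> G B by move=> /GP[].
have GC B : G B -> G (~` B).
  by move=> [mB rB rCB]; split; rewrite ?setCK//; exact: measurableC.
apply: smallest_sub.
  split.
  - split => // e e0; [exists set0|exists setT]; split => //.
    + by rewrite set0D measure0 lee_fin ltW.
    + by move=> x _; exists 0%N.
    + by rewrite setC0 setDv measure0 lee_fin ltW.
  - by move=> B GB; rewrite setTD; exact: GC.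
  - change (forall F : nat -> set (config n), (forall i, G (F i)) -> G (\bigcup_i F i)).
    move=> F GF; have mF i : measurable (F i) by have [] := GF i.
    have mUF := bigcupT_measurable F mF.
    split => // e e0.
      have [U [oU FU Ue]] := outer_regular_approx e0 mF (fun i => let: And3 _ r _ := GF i in r).
      exists (\bigcup_i U i); split.
      + exact: open_config_bigcup.
      + by move=> x [i _ Fx]; exists i => //; exact: FU.
      apply: le_trans Ue; apply: le_measure; rewrite ?inE.
      + by apply: measurableD => //; apply: open_config_measurable; exact: open_config_bigcup.
      + by apply: bigcupT_measurable => i; apply: measurableD => //; exact: open_config_measurable.
      + move=> x [[i _ Ux] nF]; exists i => //; split => // Fx.
        by apply: nF; exists i.
    have e20 : 0 < e / 2 by rewrite divr_gt0.
    have mCF i : measurable (~` F i) by exact: measurableC.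
    have [U [oU FU Ue]] := outer_regular_approx e20 mCF (fun i => let: And3 _ _ r := GF i in r).
    (* A countable intersection of open sets need not be open; a finite one is, and the mass [D N]
       of the truncation error tends to 0. *)
    pose D N := (\bigcap_(i < N) ~` F i) `\` (\bigcap_i ~` F i).
    have mD N : measurable (D N).
      by apply: measurableD; apply: bigcap_measurableType => i _; exact: mCF.
    have [N DN] : exists N, (nu (D N) <= (e / 2)%:E)%E.
      have D0 : \bigcap_N D N = set0.
        apply/seteqP; split => // x Dx; have [_ []] := Dx 0%N Logic.I.
        move=> i _; have [+ _] := Dx i.+1 Logic.I.
        by apply => /=.
      have : nu \o D @ \oo --> nu (\bigcap_N D N).
        apply: nonincreasing_cvg_mu => //.
        - by rewrite -ge0_fin_numE ?fin_num_measure.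
        - by rewrite D0.
        - move=> i j ij; apply/subsetPset => x [Dx h]; split => // k /= ki.
          by apply: Dx => /=; exact: leq_trans ki ij.
      rewrite D0 measure0 => /fine_cvgP[_] /cvgrPdist_le /(_ _ e20) [N _ /(_ N (leqnn N))].
      rewrite /= sub0r normrN ger0_norm ?fine_ge0// => h.
      by exists N; rewrite -[leLHS]fineK ?lee_fin// fin_num_measure.
    exists (\bigcap_(i < N) U i); split.
    + exact: open_config_bigcap.
    + move=> x nF i _; apply: FU => Fx; apply: nF; exists i => //.
    have mU : measurable (\bigcap_(i < N) U i) by apply: open_config_measurable; exact: open_config_bigcap.
    have mUU : measurable (\bigcup_i (U i `\` ~` F i)).
      by apply: bigcupT_measurable => i; apply: measurableD => //; exact: open_config_measurable.
    have -> : e = e / 2 + e / 2 by rewrite -splitr.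
    rewrite EFinD; apply: le_trans (leeD Ue DN).
    apply: le_trans (measureU2 _ _ _) => //; apply: le_measure; rewrite ?inE.
    + by apply: measurableD => //; exact: measurableC.
    + exact: measurableU.
    + move=> x [Ux nF].
      have [h|h] := pselect (exists2 i, (i < N)%N & F i x).
        by left; case: h => i iN Fx; exists i => //; split; [exact: Ux|move=> /(_ Fx)].
      right; split; first by move=> i /= iN Fx; apply: h; exists i.
      by rewrite -setC_bigcup.
move=> C [j [B ->]].
have clopen B' : outer_regular nu [set x : config n | B' (x j)].
  move=> e e0; exists [set x | B' (x j)]; split => //.
    by move=> x Bx; exists j.+1 => y xy /=; rewrite -xy.
  by rewrite setDv measure0 lee_fin ltW.
split; [exact: measurable_coord|exact: clopen|exact: (clopen (~` B))].
Qed.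

Lemma open_config_cvg nu U (e : R) : open_config U -> 0 < e ->
  exists m, (nu U <= nu (inner_cylinder m U) + e%:E)%E.
Proof.
move=> oU e0.
have mC m : measurable (inner_cylinder m U) by exact: cylinder_measurable (@inner_cylinderP m U).
have mU := open_config_measurable oU.
have : nu \o inner_cylinder ^~ U @ \oo --> nu U.
  rewrite [X in _ --> nu X](bigcup_inner_cylinder oU).
  apply: nondecreasing_cvg_mu => //; last exact: nondecreasing_inner_cylinder.
  by rewrite -bigcup_inner_cylinder.
rewrite -[nu U]fineK ?fin_num_measure// => /fine_cvgP[_] /cvgrPdist_le /(_ _ e0).
move=> [m _ /(_ m (leqnn m))] /=; rewrite ler_norml => /andP[_ h]; exists m.
rewrite -[X in (_ <= X + _)%E]fineK ?fin_num_measure//.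
by rewrite -EFinD lee_fin; lra.
Qed.

Definition le_config x y := forall i, (x i <= y i)%N.

(* Koenig's lemma in place of the compactness of [{x | x <= y}]. *)
Lemma open_config_below U y : open_config U -> (forall x, le_config x y -> U x) ->
  exists m, forall x, (forall i, (i < m)%N -> (x i <= y i)%N) -> U x.
Proof.
move=> oU yU; apply: contrapT => noM.
(* The prefix of [z] of length [j] has, for every [m], an extension outside [U] lying below [y] on
   the first [m] coordinates. *)
pose bad j (z : T) := forall m, exists x,
  [/\ agree j x z, forall i, (i < m)%N -> (x i <= y i)%N & ~ U x].
have bad0 z : bad 0%N z.
  move=> m; apply: contrapT => h; apply: noM; exists m => x xy.
  by apply: contrapT => Ux; apply: h; exists x.
have badS j z : bad j z -> exists k, bad j.+1 (upd j k z).
  move=> bz; apply: contrapT => h.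
  have nb (k : X) : exists m, forall x, agree j.+1 x (upd j k z) ->
      (forall i, (i < m)%N -> (x i <= y i)%N) -> U x.
    apply: contrapT => h1; apply: h; exists k => m; apply: contrapT => h2.
    apply: h1; exists m => x xz xy; apply: contrapT => Ux; apply: h2; by exists x.
  pose M k := sval (cid (nb k)).
  have MP k := svalP (cid (nb k)) : forall x, agree j.+1 x (upd j k z) ->
      (forall i, (i < M k)%N -> (x i <= y i)%N) -> U x.
  (* If each letter failed to prolong the prefix, the largest of the finitely many bounds [M k]
     would contradict badness. *)
  have [x [xz xy Ux]] := bz (\max_k M k).
  apply: Ux; apply: (MP (x j)) => [i|i iM].
    rewrite ltnS leq_eqVlt /upd; case: eqP => [->//|_ /=]; exact: xz.
  by apply: xy; apply: leq_trans iM (leq_bigmax _).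
pose next j (z : {z | bad j z}) : {z | bad j.+1 z} :=
  exist _ (upd j (sval (cid (badS j _ (svalP z)))) (sval z)) (svalP (cid (badS j _ (svalP z)))).
pose zs := fix zs j : {z | bad j z} :=
  if j is j'.+1 then next j' (zs j') else exist _ y (bad0 y).
pose z i := sval (zs i.+1) i.
have zsE j i : (i < j)%N -> sval (zs j) i = z i.
  elim: j => // j IH; rewrite ltnS leq_eqVlt => /orP[/eqP ->//|ij].
  by rewrite /= /upd ltn_eqF// IH.
have zy : le_config z y.
  move=> i; have [x [xz xy _]] := svalP (zs i.+1) i.+1.
  by rewrite /z -xz// xy.
have [m hm] := oU z (yU z zy).
have [x [xz _ Ux]] := svalP (zs m) m.
by apply: Ux; apply: hm => i im; rewrite xz// zsE.
Qed.

(** The decreasing complement [D] is enclosed in an open [U] with nearly the same [nu]-mass. The set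
    [V] of points with everything below them in [U] contains [D], and is open by
    [open_config_below]. Its inner cylinder [C] is decreasing and nearly exhausts [V] under [nu'];
    finite-dimensional domination applies to [C]. *)
Lemma product_dominated_increasing (mu mu' : probability X R) nu nu' A :
  is_product_measure mu nu -> is_product_measure mu' nu' ->
  (forall m, mean (weight mu) (up m) <= mean (weight mu') (up m)) ->
  measurable A -> increasing A -> (nu A <= nu' A)%E.
Proof.
move=> hnu hnu' dom mA hA.
pose D := ~` A.
have mD : measurable D by exact: measurableC.
have decD x y : D y -> le_config x y -> D x by move=> Dy xy Ax; apply: Dy; exact: hA Ax xy.
suff DD : (nu' D <= nu D)%E.
  move: DD; rewrite !probability_setC// -[nu A]fineK ?fin_num_measure//.
  rewrite -[nu' A]fineK ?fin_num_measure// -!EFinB !lee_fin; lra.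
apply/lee_addgt0Pr => e e0; have e20 : 0 < e / 2 by rewrite divr_gt0.
have [U [oU DU UD]] := measurable_outer_regular nu mD e20.
pose V : set (config n) := [set y | forall x, le_config x y -> U x].
pose W m : set (config n) :=
  [set y | forall x : T, (forall i, (i < m)%N -> (x i <= y i)%N) -> U x].
have VW y : V y -> exists m, W m y by move=> Vy; exact: open_config_below.
have WV m : W m `<=` V by move=> y Wy x xy; apply: Wy.
have cW m : cylinder m (W m).
  by move=> x y xy Wx z zy; apply: Wx => i im; rewrite xy// zy.
have oV : open_config V.
  move=> y /VW [m Wy]; exists m => z yz; apply: (WV m); exact: cW yz Wy.
have DV : D `<=` V by move=> y Dy x xy; apply: DU; exact: decD xy.
have mV := open_config_measurable oV.
have mU := open_config_measurable oU.
have VU : V `<=` U by move=> y; apply => i.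
have [m Vm] := open_config_cvg nu' oV e20.
set C := inner_cylinder m V in Vm.
have cC : cylinder m C by exact: inner_cylinderP.
have mC := cylinder_measurable cC.
have decC x y : C y -> le_config x y -> C x.
  move=> Cy xy z xz w wz; apply: (Cy (glue m y z)).
    by move=> i im; rewrite /glue im.
  move=> i; rewrite /glue; case: ifP => im; last exact: wz.
  by apply: leq_trans (wz i) _; rewrite -xz.
have CC : (nu' C <= nu C)%E.
  rewrite -[leLHS]fineK ?fin_num_measure// -[leRHS]fineK ?fin_num_measure// lee_fin.
  pose o : T := fun=> ord0.
  rewrite -(cylinder_prob o hnu cC) -(cylinder_prob o hnu' cC).
  have := @expec_dominated R n _ _ (coords m) (fun x => 1 - \1_C x) o
    (weightP mu) (weightP mu') dom.
  rewrite !expecB !expec_cst; try exact: weightP.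
  suff h : nondecr_fun (fun x => 1 - \1_C x : R) by move=> /(_ h); lra.
  move=> x y xy; rewrite lerB// !indicE ler_nat.
  have [Cy|//] := boolP (y \in C).
  by rewrite (mem_set (decC _ _ (set_mem Cy) xy)).
have UDe : (nu U <= nu D + (e / 2)%:E)%E.
  rewrite (measureDI nu mU mD) setIidr// addeC leeD2l//.
have -> : e = e / 2 + e / 2 by rewrite -splitr.
apply: (@le_trans _ _ (nu' V)); first by apply: le_measure; rewrite ?inE.
apply: (le_trans Vm); rewrite EFinD addeA leeD2r//.
apply: le_trans CC _; apply: le_trans UDe; apply: le_measure; rewrite ?inE//.
by apply: subset_trans VU; exact: inner_cylinder_sub.
Qed.

(** The conditional probability given a long prefix nearly equals the indicator of [A], so its
    variance nearly reaches [g (1 - g)]. *)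
Lemma cond_prob_variance_approx mu nu A x (v : R) : is_product_measure mu nu -> measurable A ->
  v < fine (nu A) * (1 - fine (nu A)) ->
  exists m, v <= expec (weight mu) (coords m) (fun x => cond_prob nu m A x ^+ 2) x
                 - fine (nu A) ^+ 2.
Proof.
move=> hnu mA hv; set g := fine (nu A) in hv *.
pose e := (g * (1 - g) - v) / 3.
have e0 : 0 < e by rewrite /e; lra.
have [U [oU AU UA]] := measurable_outer_regular nu mA e0.
have [m Um] := open_config_cvg nu oU e0.
have mU := open_config_measurable oU.
set C := inner_cylinder m U in Um.
have cC : cylinder m C by exact: inner_cylinderP.
have mC := cylinder_measurable cC.
have mAC : measurable (A `&` C) by exact: measurableI.
have mUA : measurable (U `\` A) by exact: measurableD.
have UE : fine (nu U) = fine (nu (U `\` A)) + g.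
  by rewrite (measureDI nu mU mA) setIidr// fineD ?fin_num_measure.
have UAe : fine (nu (U `\` A)) <= e.
  by rewrite -lee_fin fineK ?fin_num_measure.
have UCe : fine (nu U) <= fine (nu C) + e.
  by rewrite -lee_fin EFinD !fineK ?fin_num_measure.
have CU : fine (nu C) <= fine (nu U).
  apply: fine_le; rewrite ?fin_num_measure//.
  by apply: le_measure; rewrite ?inE//; exact: inner_cylinder_sub.
have ACe : g - e <= fine (nu (A `&` C)).
  have : fine (nu U) <= fine (nu (U `\` C)) + fine (nu C).
    rewrite (measureDI nu mU mC) setIidr; last exact: inner_cylinder_sub.
    by rewrite fineD ?fin_num_measure//; exact: measurableD.
  have UCE : fine (nu (U `\` C)) + fine (nu C) = fine (nu U).
    rewrite [in RHS](measureDI nu mU mC) setIidr; last exact: inner_cylinder_sub.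
    by rewrite fineD ?fin_num_measure//; exact: measurableD.
  have : fine (nu A) <= fine (nu (A `&` C)) + fine (nu (U `\` C)).
    rewrite (measureDI nu mA mC) fineD ?fin_num_measure//; last exact: measurableD.
    rewrite addrC lerD2l; apply: fine_le; rewrite ?fin_num_measure//; try exact: measurableD.
    by apply: le_measure; rewrite ?inE; [exact: measurableD..|exact: setSD].
  by rewrite -/g; lra.
exists m.
have secAC y : cond_prob nu m (A `&` C) y = cond_prob nu m A y * \1_C y.
  rewrite indicE; have [Cy|Cy] := boolP (y \in C).
    rewrite mulr1; congr (fine (nu _)); apply/seteqP; split => z /=; first by case.
    move=> Az; split => //; apply: cC (set_mem Cy) => i im; by rewrite /glue im.
  rewrite mulr0 /cond_prob (_ : [set z | _] = set0) ?measure0//.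
  apply/seteqP; split => z //= [_ Cz]; move: Cy; rewrite notin_setE; apply.
  by apply: cC Cz => i im; rewrite /glue im.
(* Expand the square of [cond_prob nu m A - \1_C]. Since [A] and [C] nearly coincide, the left side
   is at least [g - 3 e], which explains the division by 3 in [e]. *)
have : 2 * fine (nu (A `&` C)) - fine (nu C) <=
    expec (weight mu) (coords m) (fun x => cond_prob nu m A x ^+ 2) x.
  rewrite -(expec_cond_prob m x hnu mAC) -(cylinder_prob x hnu cC) -expecZ -expecB.
  apply: expec_le => [|y]; first exact: weightP.
  rewrite secAC; have : (\1_C y : R) ^+ 2 = \1_C y.
    by rewrite indicE; case: (y \in C); rewrite ?expr1n ?expr0n.
  by have := sqr_ge0 (cond_prob nu m A y - \1_C y); nra.
have := expr2 g; rewrite /e in ACe UCe UAe *; lra.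
Qed.

(** As [A] is increasing, the event that it still holds after the reset is contained in it, and
    [pivotal A j] is the difference. *)
Lemma prob_pivotal mu nu m j A x : is_product_measure mu nu -> measurable A ->
  increasing A -> (j < m)%N ->
  expec (weight mu) (coords m)
    (fun x => cond_prob nu m A x - cond_prob nu m A (upd j ord0 x)) x
  = fine (nu (pivotal A j)).
Proof.
move=> hnu mA hA jm.
pose B : set (config n) := [set y | A (upd j ord0 y)].
have mB : measurable B by exact: measurable_upd.
have BA : B `<=` A.
  by move=> y By; apply: hA By _ => i; rewrite /upd; case: (i == j).
have -> : (fun x => cond_prob nu m A x - cond_prob nu m A (upd j ord0 x)) =
   (fun x => cond_prob nu m A x - cond_prob nu m B x).
  apply/funext => y; congr (_ - fine (nu _)); apply/seteqP.
  suff E z : glue m (upd j ord0 y) z = upd j ord0 (glue m y z).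
    by split => z; rewrite /B /= E.
  apply/funext => i; rewrite /glue /upd.
  by case: (eqVneq i j) => [->|//]; rewrite jm.
rewrite expecB (expec_cond_prob m x hnu mA) (expec_cond_prob m x hnu mB).
have -> : pivotal A j = A `\` B by [].
rewrite measureD//; last by rewrite -ge0_fin_numE ?fin_num_measure.
by rewrite setIidr// fineB ?fin_num_measure.
Qed.

End cylinders.

(** * One-sided increments of differentiable functions and Bernoulli's inequality *)

Section right_increments.
Context {R : realType}.

Lemma derive1_increment (f : R -> R) s c : derivable f s 1 -> c < derive1 f s ->
  exists2 d, 0 < d & forall t, s < t < s + d -> c * (t - s) <= f t - f s.
Proof.
move=> fs cf.
have : h^-1 *: (f (h *: 1 + s) - f s) @[h --> 0^'] --> derive1 f s.
  by rewrite derive1E.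
move=> /cvgrPdist_lt /(_ (derive1 f s - c)); rewrite subr_gt0 => /(_ cf).
move=> /nbhs_ballP[d /= d0 hd]; exists d => // t /andP[st td].
have ts : 0 < t - s by rewrite subr_gt0.
have := hd (t - s); rewrite /ball/= sub0r normrN gtr0_norm// gt_eqF//.
rewrite ltrBlDl td => /(_ isT isT); rewrite [_ *: 1]mulr1 subrK ltr_norml => /andP[_].
rewrite ltrBlDr addrC -ltrBlDr opprB addrCA subrr addr0.
by rewrite /GRing.scale/= mulrC ltr_pdivlMr// => /ltW.
Qed.

Lemma derive1_ge0_increasing (f : R -> R) s d : derivable f s 1 -> 0 < d ->
  (forall t, s < t < s + d -> f s <= f t) -> 0 <= derive1 f s.
Proof.
move=> fs d0 fd; rewrite leNgt; apply/negP => f0.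
have fNs : derivable (- f) s 1 by exact: derivableN.
have : - derive1 f s / 2 < derive1 (- f) s.
  by rewrite [ltRHS]derive1E deriveN// -derive1E; lra.
move=> /(derive1_increment fNs)[d' d'0 h].
pose u := Num.min d d' / 2.
have u0 : 0 < u by rewrite divr_gt0// lt_min d0.
have [ud ud'] : u < d /\ u < d'.
  have : Num.min d d' <= d /\ Num.min d d' <= d' by rewrite !ge_min !lexx orbT.
  by rewrite /u in u0 *; move=> []; lra.
have su t : u < t -> s < s + u < s + t by move=> ut; rewrite ltrDl u0/= ltrD2l.
have h1 := fd _ (su _ ud); have h2 := h _ (su _ ud').
have h3 : (- f) (s + u) - (- f) s = f s - f (s + u).
  by rewrite -[(- f) (s + u)]/(- f (s + u)) -[(- f) s]/(- f s); lra.
have h4 : 0 < - derive1 f s / 2 * u by rewrite mulr_gt0//; lra.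
have h5 : s + u - s = u by ring.
by move: h2; rewrite h3 h5; lra.
Qed.

Lemma common_right_nbhs (I : finType) (s : R) (P : I -> R -> Prop) :
  (forall i, exists2 d, 0 < d & forall t, s < t < s + d -> P i t) ->
  exists2 d, 0 < d & forall t, s < t < s + d -> forall i, P i t.
Proof.
move=> h.
suff [d d0 hd] : exists2 d, 0 < d &
    forall t, s < t < s + d -> forall i, i \in enum I -> P i t.
  by exists d => // t /hd + i; apply; rewrite mem_enum.
elim: (enum I) => [|i r [d d0 IH]]; first by exists 1.
have [e e0 he] := h i; exists (Num.min d e); first by rewrite lt_min d0.
move=> t /andP[st]; rewrite -ltrBlDl lt_min !ltrBlDl => /andP[td te] k.
rewrite in_cons => /predU1P[->|kr]; first by apply: he; rewrite st.
by apply: IH kr; rewrite st.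
Qed.

Lemma bernoulli_inequality (m : nat) (u : R) : 0 <= u <= 1 ->
  1 - m%:R * u <= (1 - u) ^+ m.
Proof.
move=> /andP[u0 u1]; elim: m => [|m IH]; first by rewrite mul0r subr0.
rewrite exprS; apply: (@le_trans _ _ ((1 - u) * (1 - m%:R * u))).
  have : 0 <= m%:R * u * u by rewrite !mulr_ge0.
  by rewrite -natr1; lra.
by rewrite ler_wpM2l// subr_ge0.
Qed.

End right_increments.

(** * The differential inequality for the probability of an increasing event *)

Section threshold.
Context {R : realType} {n : nat} (a b : \bar R).
Context (mu : R -> probability (letter n) R) (nu : R -> probability (config n) R).
Notation X := (letter n).
Notation T := (nat -> X).
Implicit Types (k : X) (s t : R).

Hypothesis hdiff : forall k t, (a < t%:E < b)%E ->
  derivable (fun s : R => fine (mu s [set k])) t 1.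
Hypothesis hincr : forall k, (0 < k)%N ->
  forall s t : R, (a < s%:E < b)%E -> (a < t%:E < b)%E -> s < t ->
  (mu s (upset k) < mu t (upset k))%E.
Hypothesis hnu : forall t : R, (a < t%:E < b)%E -> is_product_measure (mu t) (nu t).

Let p t : X -> R := weight (mu t).

Lemma fine_upset t k : fine (mu t (upset k)) = mean (p t) (up k).
Proof.
rewrite fine_letter_set; congr mean; apply/funext => i.
by rewrite indicE /up /upset; congr (nat_of_bool _)%:R; apply/idP/idP; rewrite inE.
Qed.

Lemma up_inord m : (m <= n)%N -> up m = up (inord m : X) :> (X -> R).
Proof. by move=> mn; rewrite inordK. Qed.

Lemma derivable_upset k t : (a < t%:E < b)%E ->
  derivable (fun s : R => fine (mu s (upset k))) t 1.
Proof.
move=> abt; rewrite (_ : (fun s => _) = \sum_i (up k i \*o (fun s : R => p s i))).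
  apply: derivable_sum => i; apply: derivableZ; exact: hdiff.
apply/funext => s; rewrite fine_upset /mean fct_sumE; apply: eq_bigr => i _.
by rewrite mulrC.
Qed.

Lemma upset_dominated s t : (a < s%:E < b)%E -> (a < t%:E < b)%E -> s <= t ->
  forall m, mean (p s) (up m) <= mean (p t) (up m).
Proof.
move=> abs abt; rewrite le_eqVlt => /predU1P[->//|st] [|m].
  by rewrite (_ : up 0 = fun=> 1)// !mean_cst//; exact: weightP.
have [mn|nm] := ltnP m n.
  rewrite up_inord// -!fine_upset; apply: fine_le; [exact: fin_num_measure..|].
  by apply/ltW/hincr => //; rewrite inordK.
rewrite (_ : up m.+1 = fun=> 0) ?mean_cst//; try exact: weightP.
apply/funext => i; rewrite /up; case: ltnP => // mi.
by have := leq_ltn_trans nm (leq_trans mi (leq_ord i)); rewrite ltnn.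
Qed.

Section increasing_event.
Context (A : set (config n)) (mA : measurable A) (hA : increasing A).
Let g t := fine (nu t A).

Lemma prob01 t : 0 <= g t <= 1.
Proof.
rewrite /g fine_ge0//= -lee_fin fineK ?fin_num_measure//; exact: probability_le1.
Qed.

Lemma prob_nondecr s t : (a < s%:E < b)%E -> (a < t%:E < b)%E -> s <= t -> g s <= g t.
Proof.
move=> abs abt st; apply: fine_le; rewrite ?fin_num_measure//.
apply: (product_dominated_increasing (hnu abs) (hnu abt)) => //.
exact: upset_dominated.
Qed.

Lemma measurable_pivotal j : measurable (pivotal A j).
Proof. by apply: measurableD => //; exact: measurable_upd. Qed.

Lemma gamma_ge t j : fine (nu t (pivotal A j)) <= gamma nu A t.
Proof.
apply: ub_le_sup; last by exists j.
exists 1 => _ [i _ <-]; rewrite -lee_fin fineK ?fin_num_measure//.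
  by apply: probability_le1; exact: measurable_pivotal.
exact: measurable_pivotal.
Qed.

Lemma gamma01 t : 0 <= gamma nu A t <= 1.
Proof.
apply/andP; split; first by apply: le_trans (gamma_ge t 0); exact: fine_ge0.
apply: ge_sup; first by exists (fine (nu t (pivotal A 0))); exists 0%N.
move=> _ [i _ <-]; rewrite -lee_fin fineK ?fin_num_measure//.
  by apply: probability_le1; exact: measurable_pivotal.
exact: measurable_pivotal.
Qed.

(** A hybrid measure is inserted between [s] and [t]: the first [m] letters at parameter [t], the
    tail still at [s]. Reaching it gains the influence term, and moving the tail afterwards can only
    increase the probability. *)
Lemma prob_increment s t d e m (x : T) : (a < s%:E < b)%E -> (a < t%:E < b)%E ->
  s < t -> 0 <= d -> 0 <= e <= 1 -> (forall i, e * p s i <= p t i) ->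
  (forall m, (0 < m <= n)%N -> mean (p s) (up m) + d <= mean (p t) (up m)) ->
  d * e ^+ m * \sum_(j <- coords m) expec (p s) (coords m) (osc j (cond_prob (nu s) m A)) x
  <= g t - g s.
Proof.
move=> abs abt st d0 e01 epq pq.
have hF := cond_prob_nondecr (nu s) m mA hA.
have := @expec_increment R n (p s) (p t) d e (coords m) _ x (weightP _) (weightP _)
  (uniq_coords m) d0 e01 epq pq hF.
rewrite /p (expec_cond_prob m x (hnu abs) mA) size_rev size_iota -/(g s) -!/(p _).
suff : expec (p t) (coords m) (cond_prob (nu s) m A) x <= g t by lra.
rewrite /g -(expec_cond_prob m x (hnu abt) mA); apply: expec_le => [|y]; first exact: weightP.
apply: fine_le; [by apply: fin_num_measure; exact: measurable_glue..|].
apply: (product_dominated_increasing (hnu abs) (hnu abt)).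
- by apply: upset_dominated => //; exact: ltW.
- exact: measurable_glue.
- move=> z w Az zw; apply: hA Az _ => i.
  by rewrite /glue; case: (i < m)%N.
Qed.

(** Since [k] is strictly below the target, there is room for three losses: a finite [m] in the
    variance, the factor [e ^+ m] of the hybrid argument, and a factor [e] in the growth of the
    tails [mu t (upset k)]. *)
Lemma prob_logistic_at t2 s (S c : R) : (a < s%:E < b)%E -> (a < t2%:E < b)%E ->
  0 < S -> (forall k, (0 < k)%N -> S <= derive1 (fun t => fine (mu t (upset k))) s) ->
  0 < c < 1 -> gamma nu A s <= c -> gamma nu A s * - ln c <= c ->
  logistic_at g (S * - ln c) t2 s.
Proof.
move=> abs abt2 S0 hS c01 gc glc k kK.
have abI t : s < t -> t <= t2 -> (a < t%:E < b)%E.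
  move=> st tt2; have /andP[as_ _] := abs; have /andP[_ tb] := abt2.
  apply/andP; split; first by apply: lt_trans as_ _; rewrite lte_fin.
  by apply: le_lt_trans tb; rewrite lee_fin.
have [k0|k0] := leP k 0.
  exists 1 => // t /andP[st _] tt2.
  apply: (@le_trans _ _ 0); first by apply: mulr_le0_ge0; rewrite ?subr_ge0// ltW.
  by rewrite subr_ge0; apply: prob_nondecr (ltW st) => //; exact: abI.
have L0 : 0 < - ln c by rewrite oppr_gt0 ln_lt0.
have SL0 : 0 < S * - ln c by rewrite mulr_gt0.
pose x : T := fun=> ord0.
have [m hm] : exists m, k < S * \sum_(j <- coords m)
    expec (p s) (coords m) (osc j (cond_prob (nu s) m A)) x.
  pose v := (k / (S * - ln c) + g s * (1 - g s)) / 2.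
  have kv : k / (S * - ln c) < g s * (1 - g s) by rewrite ltr_pdivrMr// mulrC.
  have [m hm] := @cond_prob_variance_approx R n (mu s) (nu s) A x v (hnu abs) mA
    ltac:(rewrite -/(g s) /v; lra).
  exists m; have /andP[g0 g1] := gamma01 s.
  have := @total_influence_ge R n (p s) (coords m) (cond_prob (nu s) m A) x (gamma nu A s) c
    (weightP _) (uniq_coords m) (cond_prob_nondecr _ m mA hA) _ g0 c01 gc glc _.
  rewrite /p (expec_cond_prob m x (hnu abs) mA) -/(g s) -/(p s) => h.
  apply: (@lt_le_trans _ _ (S * (- ln c * v))).
    by rewrite mulrA mulrC -ltr_pdivrMr// /v; lra.
  rewrite ler_pM2l//; apply: le_trans (h _ _).
  - by rewrite ler_pM2l.
  - by move=> y; rewrite cond_prob_ge0 cond_prob_le1.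
  - by move=> j; rewrite mem_coords => jm; rewrite prob_pivotal//; [exact: gamma_ge|exact: hnu].
set J := \sum_(j <- _) _ in hm.
have J0 : 0 < J by rewrite -(pmulr_rgt0 _ S0); exact: lt_trans hm.
pose r := k / (S * J).
have r0 : 0 < r by rewrite divr_gt0// mulr_gt0.
have r1 : r < 1 by rewrite ltr_pdivrMr ?mulr_gt0// mul1r.
(* By Bernoulli this gives [e ^+ m.+1 >= r]. The exponent is [m.+1] because the slope [S * e]
   contributes one more factor than the [m] switched letters. *)
pose e := 1 - (1 - r) / m.+1%:R.
have m0 : 0 < m.+1%:R :> R by rewrite ltr0n.
have e1 : e < 1 by rewrite /e ltrBlDl ltrDr divr_gt0// subr_gt0.
have e0 : 0 <= e.
  by rewrite subr_ge0 ler_pdivrMr// mul1r (@le_trans _ _ 1) ?ler1n//; lra.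
have er : r <= e ^+ m.+1.
  apply: le_trans (bernoulli_inequality m.+1 _).
    by rewrite /e mulrCA divff ?gt_eqF// mulr1; lra.
  apply/andP; split; first by rewrite divr_ge0// subr_ge0 ltW.
  by rewrite ler_pdivrMr// mul1r (@le_trans _ _ 1) ?ler1n//; lra.
have Se : S * e < S by rewrite gtr_pMr.
have [d1 d10 h1] : exists2 d, 0 < d & forall t, s < t < s + d ->
    forall i : X, (0 < i)%N -> S * e * (t - s) <= mean (p t) (up i) - mean (p s) (up i).
  apply: common_right_nbhs => i.
  have [i0|i0] := posnP i; first by exists 1 => // t _; rewrite i0.
  have [d d0 hd] := derive1_increment (@derivable_upset i s abs) (lt_le_trans Se (hS i i0)).
  by exists d => // t /hd; rewrite !fine_upset.
have [d2 d20 h2] : exists2 d, 0 < d & forall t, s < t < s + d ->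
    forall i : X, e * p s i <= p t i.
  apply: common_right_nbhs => i; have [p0 _] := weightP (mu s).
  have := p0 i; rewrite le_eqVlt => /predU1P[pi0|pi0].
    by exists 1 => // t _; rewrite /p -pi0 mulr0; case: (weightP (mu t)).
  set f := fun s : R => fine (mu s [set i]).
  have [d d0 hd] := derive1_increment (@hdiff i s abs)
    (ltac:(rewrite ltrBlDl ltrDr//) : derive1 f s - 1 < derive1 f s).
  set c' := derive1 f s - 1 in hd.
  have c'0 : 0 < `|c'| + 1 by rewrite ltr_wpDl.
  (* Within this distance the mass of the letter drops by at most [(1 - e) * p s i]. *)
  exists (Num.min d ((1 - e) * p s i / (`|c'| + 1))).
    by rewrite lt_min d0/= divr_gt0// mulr_gt0// subr_gt0.
  move=> t /andP[st]; rewrite -ltrBlDl lt_min => /andP[td]; rewrite ltr_pdivlMr// => tc.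
  have := hd t; rewrite st -ltrBlDl td => /(_ isT).
  rewrite /f -/(weight (mu t) i) -/(weight (mu s) i) -!/(p _) => h.
  have : `|c'| * (t - s) + c' * (t - s) >= 0.
    rewrite -mulrDl mulr_ge0// ?subr_ge0 ?(ltW st)//.
    by rewrite -lerBlDr sub0r -normrN ler_norm.
  by move: st; rewrite -subr_gt0; nra.
exists (Num.min d1 d2); first by rewrite lt_min d10.
move=> t /andP[st]; rewrite -ltrBlDl lt_min => /andP[td1 td2] tt2.
have ts : 0 < t - s by rewrite subr_gt0.
have H1 := h1 t ltac:(by rewrite st -ltrBlDl).
have H2 := h2 t ltac:(by rewrite st -ltrBlDl).
have := @prob_increment s t (S * e * (t - s)) e m x abs (abI t st tt2) st _ _ H2.
rewrite -/J => h; apply: le_trans (h _ _ _).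
- have -> : S * e * (t - s) * e ^+ m * J = e ^+ m.+1 * (S * J) * (t - s).
    by rewrite exprS; ring.
  rewrite ler_pM2r//.
  have -> : k = r * (S * J) by rewrite /r divfK// gt_eqF// mulr_gt0.
  by rewrite ler_wpM2r// ltW// mulr_gt0.
- by rewrite !mulr_ge0// ltW.
- by rewrite e0 ltW.
- move=> l /andP[l0 ln]; rewrite up_inord//.
  have := H1 (inord l); rewrite inordK// => /(_ l0); lra.
Qed.

End increasing_event.

End threshold.

(** * Passage to the power [gamma_star] and conclusion *)

Section sharp_threshold.
Context {R : realType}.

Lemma powRe_ge0 (x : R) (s : \bar R) : (0 <= powRe x s)%E.
Proof.
by case: s => [u||] /=; rewrite ?lee_fin ?powR_ge0//; do 2?case: ifP => // _;
  rewrite ?leey.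
Qed.

(** The influence bound needs [0 < c < 1]. For [x] in that range [c = x] is taken; [x >= 1] is
    trivial by [B <= 1], and [x = 0] is reached by letting [c] be small. *)
Lemma le_powR_of_expR (B u x : R) : 0 <= u -> 0 <= x -> B <= 1 ->
  (forall c, x <= c -> 0 < c < 1 -> B <= expR (- (u * - ln c))) -> B <= x `^ u.
Proof.
move=> + x0 B1 hB; rewrite le_eqVlt => /predU1P[<-|u0]; first by rewrite powRr0.
have [x1|x1] := leP 1 x.
  apply: (le_trans B1); rewrite /powR gt_eqF; last exact: lt_le_trans x1.
  by rewrite -expR0 ler_expR mulr_ge0 ?ln_ge0// ltW.
move: x0; rewrite le_eqVlt => /predU1P[x0|x0]; last first.
  by rewrite /powR gt_eqF// -[u * ln x]opprK -mulrN; apply: hB; rewrite ?lexx ?x0.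
rewrite -x0 powR0 ?gt_eqF// leNgt; apply/negP => B0.
have lnB : ln B <= 0 by exact: ln_le0.
(* Chosen so that [expR (- (u * M))] is [B] divided by [expR 1], hence smaller than [B]. *)
pose M := (1 - ln B) / u; have M0 : 0 < M by rewrite divr_gt0//; lra.
have := hB (expR (- M)).
rewrite -x0 expR_ge0 expR_gt0 expR_lt1 oppr_lt0 M0 => /(_ isT isT).
rewrite expRK opprK /M mulrCA divff ?gt_eqF// mulr1.
rewrite -[leLHS]lnK ?posrE// ler_expR; lra.
Qed.

End sharp_threshold.

Theorem corollary3p1 (R : realType) (n : nat) (a b : \bar R) (hab : (a < b)%E)
  (mu : R -> probability (letter n) R)
  (hdiff : forall (k : letter n) (t : R), (a < t%:E < b)%E ->
    derivable (fun s : R => fine (mu s [set k])) t 1)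
  (hincr : forall k : letter n, (0 < k)%N ->
    forall s t : R, (a < s%:E < b)%E -> (a < t%:E < b)%E -> s < t ->
    (mu s (upset k) < mu t (upset k))%E)
  (hlima : mu (fine x) [set ord0]
    @[x --> within [set x : \bar R | (a < x < b)%E] (nbhs a)] --> 1%E)
  (hlimb : mu (fine x) [set ord_max]
    @[x --> within [set x : \bar R | (a < x < b)%E] (nbhs b)] --> 1%E)
  (nu : R -> probability (config n) R)
  (hnu : forall t : R, (a < t%:E < b)%E -> is_product_measure (mu t) (nu t))
  (A : set (config n)) (mA : measurable A) (hA : increasing A)
  (t1 t2 : R) (ht1 : (a < t1%:E < b)%E) (ht2 : (a < t2%:E < b)%E)
  (ht12 : t1 <= t2) :
  (nu t1 A * (1 - nu t2 A) <=
   powRe (gamma_star nu A t1 t2) (S_star mu t1 t2 * (t2 - t1)%:E))%E.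
Proof.
have abI t : t1 <= t <= t2 -> (a < t%:E < b)%E.
  move=> /andP[h1 h2]; have /andP[at1 _] := ht1; have /andP[_ t2b] := ht2.
  apply/andP; split; first by apply: lt_le_trans at1 _; rewrite lee_fin.
  by apply: le_lt_trans t2b; rewrite lee_fin.
have t11 : t1 <= t1 <= t2 by rewrite lexx.
pose g t := fine (nu t A).
have /andP[g10 g11] : 0 <= g t1 <= 1 := prob01 nu mA t1.
have /andP[g20 g21] : 0 <= g t2 <= 1 := prob01 nu mA t2.
have -> : (nu t1 A * (1 - nu t2 A))%E = (g t1 * (1 - g t2))%:E.
  rewrite EFinM EFinB /g !fineK ?fin_num_measure//.
(* With one letter there is a single configuration, so [A] is empty or full and the left side
   vanishes; here [S_star] would be infinite. *)
have [n0|n_gt0] := posnP n.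
  have cst x y : A x -> A y.
    move=> Ax; rewrite (_ : y = x)//; apply/funext => i.
    by move: (y i) (x i); rewrite n0 => u v; rewrite !ord1.
  apply: le_trans (powRe_ge0 _ _); rewrite lee_fin.
  have [[x Ax]|nA] := pselect (exists x, A x).
    have AT : A = setT by apply/seteqP; split => // y _; exact: cst Ax.
    by rewrite /g AT !probability_setT/= subrr mulr0.
  have A0 : A = set0 by apply/seteqP; split => // y Ay; apply: nA; exists y.
  by rewrite /g A0 !measure0/= mul0r.
have S_le t (k : letter n) : t1 <= t <= t2 -> (0 < k)%N ->
    (S_star mu t1 t2 <= (derive1 (fun s => fine (mu s (upset k))) t)%:E)%E.
  move=> tt k0; apply: (@le_trans _ _ (ereal_inf
      [set (derive1 (fun s => fine (mu s (upset k))) t)%:E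
      | k in [set k : letter n | (0 < k)%N]])).
    by apply: ereal_inf_lbound; exists t => //=; rewrite in_itv.
  by apply: ereal_inf_lbound; exists k.
have S_ge0 : (0 <= S_star mu t1 t2)%E.
  apply: le_ereal_inf_tmp => _ [t /= tt <-]; rewrite in_itv/= in tt.
  apply: le_ereal_inf_tmp => _ [k /= k0 <-]; rewrite lee_fin.
  have abt := abI t tt.
  have [d d0 hd] : exists2 d : R, 0 < d & (t%:E + d%:E < b)%E.
    have /andP[_] := abt; case: (b) => [b'||]//.
      rewrite lte_fin => tb; exists ((b' - t) / 2); first by rewrite divr_gt0 ?subr_gt0.
      by rewrite -EFinD lte_fin; lra.
    by exists 1 => //; rewrite -EFinD ltry.
  apply: (@derive1_ge0_increasing _ _ _ d) => //.
    exact: (derivable_upset hdiff).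
  move=> u /andP[tu ud]; have abu : (a < u%:E < b)%E.
    have /andP[at_ _] := abt; apply/andP; split.
      by apply: lt_trans at_ _; rewrite lte_fin.
    by apply: lt_trans hd; rewrite -EFinD lte_fin.
  by apply: fine_le; rewrite ?fin_num_measure//; apply/ltW/hincr.
(* As [0 < n], the index 1 is admissible and bounds the infimum by a real derivative. *)
have S_fin : S_star mu t1 t2 \is a fin_num.
  rewrite ge0_fin_numE//; pose k1 : letter n := inord 1.
  by apply: le_lt_trans (S_le t1 k1 t11 _) (ltry _); rewrite inordK.
rewrite -(fineK S_fin); set S := fine (S_star mu t1 t2); rewrite -EFinM/= lee_fin.
have S0 : 0 <= S by exact: fine_ge0.
have S_leR t (k : letter n) : t1 <= t <= t2 -> (0 < k)%N ->
    S <= derive1 (fun s => fine (mu s (upset k))) t.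
  by move=> tt k0; rewrite -lee_fin fineK// S_le.
pose m t := Num.max (gamma nu A t) (gamma nu A t * ln (gamma nu A t)^-1).
have m_le t : t1 <= t <= t2 -> m t <= gamma_star nu A t1 t2.
  move=> tt; apply: ub_le_sup; last by exists t => //=; rewrite in_itv.
  (* The supremum is over a bounded set: [x * ln x^-1 <= 1 - x] for [x > 0]. *)
  exists 1 => _ [u _ <-]; have /andP[h0 h1] := gamma01 nu mA u.
  rewrite ge_max h1/=; move: h0; rewrite le_eqVlt => /predU1P[<-|h0].
    by rewrite mul0r.
  have := @ln_le_subr1 R (gamma nu A u)^-1; rewrite invr_gt0 => /(_ h0).
  rewrite -(ler_pM2l h0) mulrBr divff ?gt_eqF//; lra.
have g_star0 : 0 <= gamma_star nu A t1 t2.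
  apply: le_trans (m_le t1 t11); rewrite /m le_max.
  by have /andP[-> _] := gamma01 nu mA t1.
apply: le_powR_of_expR => //.
- by rewrite mulr_ge0// subr_ge0.
- by rewrite mulr_ile1//; lra.
move=> c gc c01; have /andP[c0 c1] := c01.
move: (S0); rewrite le_eqVlt => /predU1P[<-|S_gt0].
  by rewrite !mul0r oppr0 expR0 mulr_ile1//; lra.
rewrite mulrAC; apply: logistic_growth => //.
- by rewrite mulr_ge0// oppr_ge0 ln_le0// ltW.
- move=> s t h1 h2 h3; apply: (prob_nondecr hincr hnu mA hA) => //; apply: abI.
    by rewrite h1 (le_trans h2).
  by rewrite h3 (le_trans h1).
- by move=> t _; exact: prob01.
move=> s /andP[h1 h2]; have ss : t1 <= s <= t2 by rewrite h1 ltW.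
have := m_le s ss; rewrite /m ge_max => /andP[h3 h4].
have h5 : gamma nu A s <= c by exact: le_trans gc.
apply: (prob_logistic_at hdiff hincr hnu mA hA (abI s ss) ht2) => //.
  by move=> k k0; exact: S_leR.
(* Since [gamma <= c], the factor [- ln c] is at most [ln gamma^-1], so the second half of
   [gamma_star] applies. *)
have /andP[+ _] := gamma01 nu mA s; rewrite le_eqVlt => /predU1P[<-|g0].
  by rewrite mul0r ltW.
apply: le_trans gc; apply: le_trans h4; rewrite ler_pM2l// lnV ?posrE//.
by rewrite lerN2 ler_ln ?posrE.
Qed.
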